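(* If $k>c_u(L)$, then the functional $\mathcal L_k: W^{1,2}_{x_\pm}([0,1],\mathbb R^n)\times\mathbb R^+\to\mathbb R$ has a global minimizer.
   Context: Let $\sigma>0$ and let $V:\mathbb R^n\to\mathbb R$ satisfy: (1) $V$ is of class $C^4$; (2) $U(x):=\sigma\Delta V(x)-\frac12|\nabla V(x)|^2$ is bounded from above and its maximum points are contained in a bounded domain; (3) $V$ has two local minimizers $x_0,x_1$ with $\nabla V(x_0)=\nabla V(x_1)=0$ and $\Delta V(x_0)>0$, $\Delta V(x_1)>0$. Put $L(x,v)=\frac12|v|^2-U(x)$ for $(x,v)\in\mathbb R^n\times\mathbb R^n$. Let $x_-,x_+\in\mathbb R^n$ be fixed endpoints, $\mathbb R^+=(0,\infty)$, and $W^{1,2}_{x_\pm}([0,1],\mathbb R^n)=\{x\in W^{1,2}([0,1],\mathbb R^n): x(0)=x_-,\ x(1)=x_+\}$. For $k\in\mathbb R$ define $$\mathcal L_k(x,T)=T\int_0^1\big(L(x(t),\dot x(t)/T)+k\big)\,dt .$$ The Mañé critical value is $c_u(L)=\inf\{k\in\mathbb R: \int_0^T (L(\gamma,\dot\gamma)+k)\,dt\ge 0 \text{ for all } T>0 \text{ and all absolutely continuous } \gamma:[0,T]\to\mathbb R^n\}$.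
   Formalization: The endpoints are assumed distinct, x_- ≠ x_+; for x_- = x_+ the claim fails, since L_k > 0 everywhere while constant curves give values tending to 0 as T → 0+, so the infimum 0 is not attained. *)

(* Defs.v *)
From HB Require Import structures.
From mathcomp Require Import all_boot all_order all_algebra.
From mathcomp Require Import all_classical all_reals all_analysis.

Set Implicit Arguments.
Unset Strict Implicit.
Unset Printing Implicit Defensive.

Import Order.TTheory GRing.Theory Num.Theory.
Import numFieldNormedType.Exports.

Local Open Scope classical_set_scope.
Local Open Scope ring_scope.

(* R^n is 'rV[R]_n.  The library norm `|v| on 'rV[R]_n is the sup norm; it is
   used below only for topological notions (continuity, boundedness, absolute
   continuity), where the choice of a norm is immaterial.  The Euclidean length
   entering the Lagrangian is [sqnorm]. *)

Definition sqnorm (R : realType) (n : nat) (v : 'rV[R]_n) : R :=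
  \sum_(i < n) v 0 i ^+ 2.

Definition partial (R : realType) (n : nat) (i : 'I_n) (f : 'rV[R]_n -> R)
    (x : 'rV[R]_n) : R :=
  'D_('e_i) f x.

Definition grad (R : realType) (n : nat) (f : 'rV[R]_n -> R)
    (x : 'rV[R]_n) : 'rV[R]_n :=
  \row_i partial i f x.

Definition laplacian (R : realType) (n : nat) (f : 'rV[R]_n -> R)
    (x : 'rV[R]_n) : R :=
  \sum_(i < n) partial i (partial i f) x.

Fixpoint class_C (R : realType) (n : nat) (m : nat) (f : 'rV[R]_n -> R) : Prop :=
  match m with
  | 0%N => continuous f
  | m'.+1 => continuous f /\
      forall i : 'I_n, (forall x, derivable f x 'e_i) /\ class_C m' (partial i f)
  end.

Definition local_minimizer (R : realType) (n : nat) (f : 'rV[R]_n -> R)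
    (x : 'rV[R]_n) : Prop :=
  \forall y \near x, f x <= f y.

Definition bounded_domain (R : realType) (n : nat) (D : set 'rV[R]_n) : Prop :=
  [/\ D !=set0, open D, connected D & bounded_set D].

Definition maximum_points (R : realType) (n : nat) (f : 'rV[R]_n -> R) :
    set 'rV[R]_n :=
  [set x | forall y, f y <= f x].

Definition effective_potential (R : realType) (n : nat) (sigma : R)
    (V : 'rV[R]_n -> R) (x : 'rV[R]_n) : R :=
  sigma * laplacian V x - 2^-1 * sqnorm (grad V x).

Definition lagrangian (R : realType) (n : nat) (sigma : R) (V : 'rV[R]_n -> R)
    (x v : 'rV[R]_n) : R :=
  2^-1 * sqnorm v - effective_potential sigma V x.

Definition absolutely_continuous (R : realType) (n : nat) (a b : R)
    (c : R -> 'rV[R]_n) : Prop :=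
  forall e : R, 0 < e -> exists2 d : R, 0 < d &
    forall (N : nat) (s t : 'I_N -> R),
      (forall j, a <= s j /\ s j <= t j /\ t j <= b) ->
      (forall j l, j != l -> `]s j, t j[ `&` `]s l, t l[ = set0) ->
      \sum_(j < N) (t j - s j) < d ->
      \sum_(j < N) `|c (t j) - c (s j)| < e.

(* The integral is extended-real valued: an absolutely continuous curve need
   not have a square integrable velocity.  [derive1 c] is the classical derivative,
   which exists almost everywhere on [0, T]. *)
Definition mane_critical_value (R : realType) (n : nat)
    (L : 'rV[R]_n -> 'rV[R]_n -> R) : \bar R :=
  ereal_inf [set k%:E | k in [set k : R |
    forall (T : R) (c : R -> 'rV[R]_n), 0 < T -> absolutely_continuous 0 T c ->
      (0 <= \int[lebesgue_measure]_(t in `[0%R, T])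
              (L (c t) (derive1 c t) + k)%:E)%E]].

Definition L2_01 (R : realType) (u : R -> R) : Prop :=
  measurable_fun (`]0, 1[ : set R) u /\
  (@lebesgue_measure R).-integrable `]0, 1[ (fun t => (u t ^+ 2)%:E).

Definition test_function (R : realType) (phi : R -> R) : Prop :=
  [/\ forall t, derivable phi t 1,
      continuous (derive1 phi),
      compact (closure [set t | phi t != 0]) &
      closure [set t | phi t != 0] `<=` `]0, 1[].

(* Weak derivatives are taken against C^1 compactly supported test functions,
   as is usual for W^{1,p} of an interval; smooth ones define the same notion. *)
Definition is_weak_derivative (R : realType) (u g : R -> R) : Prop :=
  L2_01 g /\
  forall phi : R -> R, test_function phi ->
    \int[lebesgue_measure]_(t in `]0, 1[) (u t * derive1 phi t)
    = - \int[lebesgue_measure]_(t in `]0, 1[) (g t * phi t).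

Definition is_weak_velocity (R : realType) (n : nat) (x g : R -> 'rV[R]_n) :
    Prop :=
  forall i : 'I_n, is_weak_derivative (fun t => x t 0 i) (fun t => g t 0 i).

(* Curves are total functions of which only the restriction to [0, 1] matters.
   Every class of W^{1,2} has a unique continuous representative on [0, 1],
   which is the one that gives a meaning to x(0) and x(1). *)
Definition W12 (R : realType) (n : nat) (x : R -> 'rV[R]_n) : Prop :=
  [/\ {within `[0, 1], continuous x},
      forall i : 'I_n, L2_01 (fun t => x t 0 i) &
      exists g : R -> 'rV[R]_n, is_weak_velocity x g].

Definition W12_between (R : realType) (n : nat) (xm xp : 'rV[R]_n) :
    set (R -> 'rV[R]_n) :=
  [set x | [/\ W12 x, x 0 = xm & x 1 = xp]].

(* A choice of the weak derivative, which is unique up to a null set. *)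
Definition velocity (R : realType) (n : nat) (x : R -> 'rV[R]_n) :
    R -> 'rV[R]_n :=
  xget (fun=> 0) [set g | is_weak_velocity x g].

Definition free_time_action (R : realType) (n : nat)
    (L : 'rV[R]_n -> 'rV[R]_n -> R) (k : R) (x : R -> 'rV[R]_n) (T : R) : R :=
  T * \int[lebesgue_measure]_(t in `[0, 1])
        (L (x t) (T^-1 *: velocity x t) + k).

(* Main.v *)
Require Import Defs.
From HB Require Import structures.
From mathcomp Require Import all_boot all_order all_algebra.
From mathcomp Require Import all_classical all_reals all_analysis.
From mathcomp Require Import measurable_realfun ring lra.

Set Implicit Arguments.
Unset Strict Implicit.
Unset Printing Implicit Defensive.

Import Order.TTheory GRing.Theory Num.Theory.
Import numFieldNormedType.Exports.

Local Open Scope classical_set_scope.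
Local Open Scope ring_scope.

(** Testing the definition of the critical value on constant curves shows that
    [k] exceeds [U] by a uniform amount [d > 0] ([potential_gap]).  The action is

      E(x) / (2 T) + T * int_0^1 (k - U(x(t))) dt,   E(x) = int_0^1 |x'|^2,

    where the integral of [k - U] is at least [d], so an upper bound on the action
    bounds [T] from above and then [E(x)]; since the endpoints differ, [E(x)] is
    bounded away from zero and hence so is [T].  This leaves the direct method: along a
    minimizing sequence the curves are uniformly 1/2-Hoelder, they and the times
    have a limit, the potential term passes to the limit by uniform convergence,
    and [E] is lower semicontinuous.

    Weak convergence in L^2 is replaced by duality.  For a continuous [u], put

      F_u(phi) = -2 int u phi' - int phi^2      ([energy_test]).

    If [u] has a weak derivative [g], completing the square gives
    [F_u(phi) <= int g^2] for all test functions [phi].  Conversely an upper bound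
    [F_u <= M] produces a weak derivative [g] with [int g^2 <= M]: by the
    parallelogram identity a maximizing sequence of test functions is Cauchy in
    L^2, and its limit is [g] ([weak_derivative_of_energy_bound]).  Each
    [F_u(phi)] is continuous in [u] for uniform convergence, so the limit curve
    lies in W^{1,2} and its energy is at most the limit of the energies.

    Two further facts tie the weak derivative to the curve.  Testing against a
    C^1 approximation of the indicator function of [[s, t]] gives
    [(u(t) - u(s))^2 <= (t - s) int g^2] ([holder_weak_derivative]).  Testing a
    function orthogonal to all test functions against the same approximations
    shows that it vanishes almost everywhere, so the energy is the same for every
    choice of the weak derivative ([weak_derivative_unique_energy]).

    Compactness uses an ultrafilter on [nat] finer than the cofinite filter:
    every bounded sequence of reals converges along it, so the values at all
    times, the energies and the travel times all converge simultaneously. *)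

(** * The inner product of L^2(0, 1) *)

Section L2.
Context (R : realType).
Local Notation mu := (@lebesgue_measure R).
Implicit Types (u v w f g : R -> R).

Definition ip u v : R := \int[mu]_(t in `]0, 1[) (u t * v t).

Lemma L2_mul_integrable u v : L2_01 u -> L2_01 v ->
  mu.-integrable `]0, 1[ (EFin \o (fun t => u t * v t)).
Proof.
move=> [mu_ iu] [mv iv].
have mI : measurable (`]0, 1[%classic : set (measurableTypeR R)) by exact: measurable_itv.
apply: le_integrable (integrableD mI iu iv) => //.
  by apply/measurable_EFinP; exact: measurable_funM.
move=> t _; rewrite /= lee_fin.
rewrite (ger0_norm (addr_ge0 (sqr_ge0 _) (sqr_ge0 _))) ler_norml.
apply/andP; split; have := sqr_ge0 (u t - v t); have := sqr_ge0 (u t + v t); nra.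
Qed.

Lemma L2_01D u v : L2_01 u -> L2_01 v -> L2_01 (fun t => u t + v t).
Proof.
move=> hu hv; have mI : measurable (`]0, 1[%classic : set (measurableTypeR R)) by exact: measurable_itv.
have [mu_ iu] := hu; have [mv iv] := hv.
split; first exact: measurable_funD.
have h := integrableZl mI 2 (L2_mul_integrable hu hv).
apply: eq_integrable (integrableD mI (integrableD mI iu iv) h) => // t _ /=.
by rewrite -EFinM -!EFinD; congr EFin; ring.
Qed.

Lemma L2_01Z c u : L2_01 u -> L2_01 (fun t => c * u t).
Proof.
move=> hu; have mI : measurable (`]0, 1[%classic : set (measurableTypeR R)) by exact: measurable_itv.
have [mu_ iu] := hu.
split; first by apply: measurable_funM => //; exact: measurable_cst.
apply: eq_integrable (integrableZl mI (c ^+ 2) iu) => // t _ /=.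
by rewrite -EFinM; congr EFin; ring.
Qed.

Lemma L2_01B u v : L2_01 u -> L2_01 v -> L2_01 (fun t => u t - v t).
Proof.
move=> hu hv; have := L2_01D hu (L2_01Z (-1) hv).
by congr L2_01; apply/funext => t; rewrite mulN1r.
Qed.

Lemma ipC u v : ip u v = ip v u.
Proof. by apply: eq_Rintegral => t _; rewrite mulrC. Qed.

Lemma ip_ge0 u : 0 <= ip u u.
Proof. by apply: Rintegral_ge0 => t _; rewrite -expr2 sqr_ge0. Qed.

Lemma ipDl u v w : L2_01 u -> L2_01 v -> L2_01 w ->
  ip (fun t => u t + v t) w = ip u w + ip v w.
Proof.
move=> hu hv hw; rewrite /ip -RintegralD //; try exact: L2_mul_integrable.
by apply: eq_Rintegral => t _; rewrite mulrDl.
Qed.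

Lemma ipZl c u w : L2_01 u -> L2_01 w -> ip (fun t => c * u t) w = c * ip u w.
Proof.
move=> hu hw; rewrite /ip -RintegralZl //; try exact: L2_mul_integrable.
by apply: eq_Rintegral => t _; rewrite mulrA.
Qed.

Lemma ipBl u v w : L2_01 u -> L2_01 v -> L2_01 w ->
  ip (fun t => u t - v t) w = ip u w - ip v w.
Proof.
move=> hu hv hw; rewrite /ip -RintegralB //; try exact: L2_mul_integrable.
by apply: eq_Rintegral => t _; rewrite mulrBl.
Qed.

Lemma ipDr u v w : L2_01 u -> L2_01 v -> L2_01 w ->
  ip w (fun t => u t + v t) = ip w u + ip w v.
Proof. by move=> *; rewrite !(ipC w) ipDl. Qed.

Lemma ipBr u v w : L2_01 u -> L2_01 v -> L2_01 w ->
  ip w (fun t => u t - v t) = ip w u - ip w v.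
Proof. by move=> *; rewrite !(ipC w) ipBl. Qed.

Lemma ipZr c u w : L2_01 u -> L2_01 w -> ip w (fun t => c * u t) = c * ip w u.
Proof. by move=> *; rewrite !(ipC w) ipZl. Qed.

(** The discriminant of a quadratic that stays nonnegative is nonpositive; [a = 0]
    is included, where the linear part has to vanish. *)
Lemma sqr_le_of_quadratic_ge0 (a b c : R) :
  0 <= a -> (forall s, 0 <= a * s ^+ 2 + 2 * b * s + c) -> b ^+ 2 <= a * c.
Proof.
rewrite le_eqVlt => /predU1P[<-|a0] h.
  have [->|b0] := eqVneq b 0; first by rewrite expr0n mul0r.
  have := h (- (c + 1) / (2 * b)).
  rewrite (_ : 0 * _ + _ + c = -1); first by lra.
  by field; rewrite b0 /=.
have := h (- b / a).
rewrite (_ : a * _ + _ + c = (a * c - b ^+ 2) / a); last by field; rewrite gt_eqF.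
by rewrite pmulr_lge0 ?invr_gt0 // subr_ge0.
Qed.

Lemma ip_cauchy_schwarz u v : L2_01 u -> L2_01 v ->
  ip u v ^+ 2 <= ip u u * ip v v.
Proof.
move=> hu hv; apply: sqr_le_of_quadratic_ge0; first exact: ip_ge0.
move=> s; have := ip_ge0 (fun t => s * u t + v t).
have hsu := L2_01Z s hu.
rewrite ipDl ?ipDr ?ipZl ?ipZr //; try exact: L2_01D.
by rewrite (ipC v u); congr (0 <= _); ring.
Qed.

Lemma ipD_sqr u v : L2_01 u -> L2_01 v ->
  ip (fun t => u t + v t) (fun t => u t + v t) = ip u u + 2 * ip u v + ip v v.
Proof.
move=> hu hv; have huv := L2_01D hu hv.
by rewrite ipDl ?ipDr // (ipC v u); ring.
Qed.

Lemma ipB_sqr u v : L2_01 u -> L2_01 v ->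
  ip (fun t => u t - v t) (fun t => u t - v t) = ip u u - 2 * ip u v + ip v v.
Proof.
move=> hu hv; have huv := L2_01B hu hv.
by rewrite ipBl ?ipBr // (ipC v u); ring.
Qed.

Lemma integrable_continuous_oo01 u :
  {within `[0, 1], continuous u} -> mu.-integrable `]0, 1[ (EFin \o u).
Proof.
move=> cu; apply: (@integrableS _ _ _ mu `[0, 1]%classic) => //.
  exact: subset_itv_oo_cc.
by apply: continuous_compact_integrable => //; exact: segment_compact.
Qed.

Lemma L2_01_continuous u : {within `[0, 1], continuous u} -> L2_01 u.
Proof.
move=> cu; split.
  have /integrableP[mu_ _] := integrable_continuous_oo01 cu.
  exact/measurable_EFinP.
apply: (@integrable_continuous_oo01 (fun t => u t ^+ 2)).
by move=> z; apply: continuousM; exact: cu.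
Qed.

Lemma L2_01_cst (c : R) : L2_01 (fun=> c).
Proof. by apply: L2_01_continuous => z; exact: cst_continuous. Qed.

Lemma ip_le u v f g : L2_01 u -> L2_01 v -> L2_01 f -> L2_01 g ->
  (forall t, 0 < t < 1 -> u t * v t <= f t * g t) -> ip u v <= ip f g.
Proof.
move=> hu hv hf hg h; apply: le_Rintegral => //; try exact: L2_mul_integrable.
Qed.

Lemma ip_cst (c d : R) : ip (fun=> c) (fun=> d) = c * d.
Proof.
rewrite /ip Rintegral_cst //= lebesgue_measure_itv /= lte_fin ltr01 oppr0 adde0.
by rewrite mulr1.
Qed.

Lemma ipE u v : L2_01 u -> L2_01 v ->
  (ip u v)%:E = (\int[mu]_(t in `]0%R, 1%R[) (u t * v t)%:E)%E.
Proof.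
move=> hu hv; rewrite /ip /Rintegral fineK //.
by apply: integrable_fin_num => //; exact: L2_mul_integrable.
Qed.

End L2.

(** * Completeness of L^2(0, 1) *)

Section L2_completeness.
Context (R : realType).
Local Notation mu := (@lebesgue_measure R).

(** The increments have L^1 norm at most [2^-m], so their sum is integrable and
    therefore finite almost everywhere: the sequence converges absolutely there. *)
Lemma cvg_fast_cauchy (f : nat -> R -> R) :
  (forall m, L2_01 (f m)) ->
  (forall m l, (m <= l)%N ->
    ip (fun t => f l t - f m t) (fun t => f l t - f m t) <= 4^-1 ^+ m) ->
  {ae mu, forall t, `]0, 1[%classic t -> cvgn (f^~ t)}.
Proof.
move=> hf hc.
have mI : measurable (`]0, 1[%classic : set (measurableTypeR R)) by exact: measurable_itv.
pose d m t : R := `|f m.+1 t - f m t|.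
have hd m : L2_01 (d m).
  have [h1 h2] := L2_01B (hf m.+1) (hf m); split.
    exact: measurableT_comp.
  by apply: eq_integrable h2 => // t _; rewrite /d /= real_normK ?num_real.
have md m : measurable_fun (`]0, 1[%classic : set (measurableTypeR R)) (EFin \o d m).
  by apply/measurable_EFinP; have [] := hd m.
have dle m : (\int[mu]_(t in `]0%R, 1%R[) (d m t)%:E <= (2 / (2 ^ (m + 1))%:R)%:E)%E.
  have -> : (\int[mu]_(t in `]0%R, 1%R[) (d m t)%:E)%E = (ip (d m) (fun=> 1))%:E.
    rewrite ipE //; last exact: L2_01_cst.
    by apply: eq_integral => t _; rewrite mulr1.
  rewrite lee_fin natrX exprD expr1 invfM mulrCA divff ?mulr1 //.
  rewrite -ler_sqr ?nnegrE; last 2 first.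
  - by apply: Rintegral_ge0 => t _; rewrite mulr1 /d.
  - by rewrite invr_ge0 exprn_ge0.
  apply: le_trans (ip_cauchy_schwarz (hd m) (L2_01_cst 1)) _.
  rewrite ip_cst !mulr1.
  have -> : ip (d m) (d m) = ip (fun t => f m.+1 t - f m t) (fun t => f m.+1 t - f m t).
    by apply: eq_Rintegral => t _; rewrite -!expr2 real_normK ?num_real.
  apply: le_trans (hc _ _ (leqnSn m)) _.
  rewrite !exprVn -exprM mulnC exprM.
  by rewrite (_ : 2 ^+ 2 = 4 :> R) //; ring.
have fin : (\int[mu]_(t in `]0%R, 1%R[) (\sum_(m <oo) (d m t)%:E) < +oo)%E.
  rewrite integral_nneseries //; last by move=> *; rewrite lee_fin normr_ge0.
  apply: (@le_lt_trans _ _ (2 / 2 ^+ 0)%:E); last exact: ltry.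
  have /cvg_lim <- // := @cvg_geometric_eseries_half R 2 0.
  apply: lee_nneseries => [m _ _|m _].
    by apply: integral_ge0 => t _; rewrite lee_fin normr_ge0.
  exact: dle.
have int : mu.-integrable `]0, 1[ (fun t => \sum_(m <oo) (d m t)%:E)%E.
  apply/integrableP; split.
    apply: (@ge0_emeasurable_sum _ _ _ _ _ xpredT) => [k t It Pk|k Pk].
      by rewrite lee_fin normr_ge0.
    exact: md.
  have absE t : `|\sum_(m <oo) (d m t)%:E|%E = (\sum_(m <oo) (d m t)%:E)%E.
    by rewrite gee0_abs // nneseries_ge0 // => *; rewrite lee_fin normr_ge0.
  by under eq_integral do rewrite absE.
apply: filterS (integrable_ae mI int) => t + It => /(_ It) h.
have : cvgn [normed series (telescope (f^~ t))].
  apply: nondecreasing_is_cvgn.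
    by apply: nondecreasing_series => *; exact: normr_ge0.
  exists (fine (\sum_(m <oo) (d m t)%:E)%E) => _ [N _ <-].
  rewrite -lee_fin fineK // /series /= -sumEFin.
  by apply: nneseries_lim_ge => m _; rewrite lee_fin.
move=> /normed_cvg hs.
have -> : f^~ t = (fun m => f 0%N t + series (telescope (f^~ t)) m).
  by apply/funext => m; exact: (eq_sum_telescope (f^~ t)).
by apply: is_cvgD => //; exact: is_cvg_cst.
Qed.

(** The limit is defined everywhere as a [limn_esup], which keeps it measurable
    where the sequence diverges; the rate survives the passage to the limit by
    Fatou's lemma. *)
Lemma L2_complete (f : nat -> R -> R) :
  (forall m, L2_01 (f m)) ->
  (forall m l, (m <= l)%N ->
    ip (fun t => f l t - f m t) (fun t => f l t - f m t) <= 4^-1 ^+ m) ->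
  exists2 g, L2_01 g &
    forall m, ip (fun t => g t - f m t) (fun t => g t - f m t) <= 4^-1 ^+ m.
Proof.
move=> hf hc.
have mI : measurable (`]0, 1[%classic : set (measurableTypeR R)) by exact: measurable_itv.
have cv := cvg_fast_cauchy hf hc.
pose g t := fine (limn_esup (fun m => (f m t)%:E)).
have mg : measurable_fun (`]0, 1[%classic : set (measurableTypeR R)) g.
  apply: (measurableT_comp (@fine_measurable _ _ measurableT)).
  by apply: measurable_fun_limn_esup => m; apply/measurable_EFinP; have [] := hf m.
have gE : {ae mu, forall t, `]0, 1[%classic t -> f^~ t @ \oo --> g t}.
  move: cv; apply: filterS; first exact: (ae_filter_ringOfSetsType mu).
  move=> t + It => /(_ It) ct.
  have ct' : (f m t)%:E @[m --> \oo] --> (limn (f^~ t))%:E by apply: cvg_EFin; [exact: nearW|exact: ct].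
  rewrite /g is_cvg_limn_esupE; last by apply/cvg_ex; eexists; exact: ct'.
  by rewrite (cvg_lim _ ct').
have key m : (\int[mu]_(t in `]0%R, 1%R[) ((g t - f m t) ^+ 2)%:E <= (4^-1 ^+ m)%:E)%E.
  pose h l t := ((f (m + l)%N t - f m t) ^+ 2)%:E.
  have mh l : measurable_fun (`]0, 1[%classic : set (measurableTypeR R)) (h l).
    by apply/measurable_EFinP; have [? _] := L2_01B (hf (m + l)%N) (hf m); exact: measurable_funX.
  have limE : ae_eq mu (`]0, 1[%classic : set (measurableTypeR R)) (fun t => ((g t - f m t) ^+ 2)%:E) (fun t => limn_einf (h^~ t)).
    move: gE; apply: filterS; first exact: (ae_filter_ringOfSetsType mu).
    move=> t + It => /(_ It) ct.
    apply/esym; have : h l t @[l --> \oo] --> ((g t - f m t) ^+ 2)%:E.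
      apply: cvg_EFin; first exact: nearW.
      have ct' : f (m + l)%N t @[l --> \oo] --> g t.
        have -> : (fun l => f (m + l)%N t) = [sequence (f^~ t) (l + m)%N]_l.
          by apply/funext => l; rewrite /= addnC.
        by rewrite (cvg_shiftn m (f^~ t) (nbhs (g t))).
      by apply: cvgM; apply: cvgB => //; exact: cvg_cst.
    by move=> /[dup] /cvg_lim + ch => <- //; rewrite is_cvg_limn_einfE //; apply/cvg_ex; eexists; exact: ch.
  have mlim : measurable_fun (`]0, 1[%classic : set (measurableTypeR R)) (fun t => limn_einf (h^~ t)).
    rewrite /limn_einf; apply: measurableT_comp => //.
    by apply: measurable_fun_limn_esup => l; exact: measurableT_comp.
  rewrite (ge0_ae_eq_integral _ _ mlim _ _ limE) //; last first.
  - move=> t _; rewrite limn_einf_lim; apply: lime_ge; first exact: is_cvg_einfs.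
    apply: nearW => l; apply: le_ereal_inf_tmp => _ [p _ <-].
    by rewrite lee_fin sqr_ge0.
  - by move=> t _; rewrite lee_fin sqr_ge0.
  - by apply/measurable_EFinP; apply: measurable_funX; apply: measurable_funB => //; have [] := hf m.
  apply: le_trans (fatou mu mI mh _) _.
    by move=> l t _; rewrite lee_fin sqr_ge0.
  rewrite limn_einf_lim; apply: lime_le; first exact: is_cvg_einfs.
  apply: nearW => l; apply: (@le_trans _ _ (\int[mu]_(t in `]0%R, 1%R[) h l t)%E).
    by apply: ereal_inf_lbound; exists l => //=.
  rewrite /h; under eq_integral do rewrite expr2.
  by rewrite -ipE ?lee_fin ?hc ?leq_addr //; exact: L2_01B.
have hB m : L2_01 (fun t => g t - f m t).
  split; first by apply: measurable_funB => //; have [] := hf m.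
  apply/integrableP; split.
    by apply/measurable_EFinP; apply: measurable_funX; apply: measurable_funB => //; have [] := hf m.
  apply: le_lt_trans (ltry (4^-1 ^+ m)); apply: le_trans (key m).
  have absE t : `|((g t - f m t) ^+ 2)%:E|%E = ((g t - f m t) ^+ 2)%:E.
    by rewrite gee0_abs // lee_fin sqr_ge0.
  by under eq_integral do rewrite absE.
exists g.
  have := L2_01D (hB 0%N) (hf 0%N).
  by congr L2_01; apply/funext => t; rewrite subrK.
move=> m; rewrite -lee_fin ipE //.
by apply: le_trans (key m); under eq_integral do rewrite -expr2.
Qed.

End L2_completeness.

(** * Weak derivatives from bounds on the dual energy *)

Section weak_derivative.
Context (R : realType).
Local Notation mu := (@lebesgue_measure R).
Implicit Types (u v w f g phi psi : R -> R).

Lemma test_continuous phi : test_function phi -> continuous phi.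
Proof. by move=> [d _ _ _] x; apply/differentiable_continuous/derivable1_diffP. Qed.

Lemma continuous_within01 phi : continuous phi -> {within `[0, 1], continuous phi}.
Proof. by move=> c; exact: continuous_subspaceT. Qed.

Lemma test_L2 phi : test_function phi -> L2_01 phi.
Proof. by move=> /test_continuous/continuous_within01/L2_01_continuous. Qed.

Lemma test_derive_L2 phi : test_function phi -> L2_01 (derive1 phi).
Proof. by move=> [_ c _ _]; exact/L2_01_continuous/continuous_within01. Qed.

Lemma derive1_lincomb phi psi (a b : R) : test_function phi -> test_function psi ->
  derive1 (fun t => a * phi t + b * psi t) =
  (fun t => a * derive1 phi t + b * derive1 psi t).
Proof.
move=> [d1 _ _ _] [d2 _ _ _]; apply/funext => t.
have h1 := d1 t; have h2 := d2 t.
rewrite !derive1E.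
have -> : (fun t => a * phi t + b * psi t) = a \*: phi + b \*: psi by [].
rewrite (deriveD (derivableZ (k := a) h1) (derivableZ (k := b) h2)).
by rewrite (deriveZ a h1) (deriveZ b h2).
Qed.

Lemma test_lincomb phi psi (a b : R) : test_function phi -> test_function psi ->
  test_function (fun t => a * phi t + b * psi t).
Proof.
move=> h1 h2; have [d1 c1 k1 s1] := h1; have [d2 c2 k2 s2] := h2.
have sub : closure [set t | a * phi t + b * psi t != 0] `<=`
  closure [set t | phi t != 0] `|` closure [set t | psi t != 0].
  rewrite -closureU; apply: closureS => t /= h.
  have [p0|] := eqVneq (phi t) 0; last by left.
  right; apply: contra_neq h => ->; rewrite p0; ring.
split.
- move=> t; have -> : (fun t => a * phi t + b * psi t) = a \*: phi + b \*: psi by [].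
  by apply: derivableD; apply: derivableZ.
- rewrite derive1_lincomb // => t.
  by apply: cvgD; apply: cvgM; [exact: cvg_cst|exact: c1|exact: cvg_cst|exact: c2].
- apply: (subclosed_compact _ _ sub); last exact: compactU.
  exact: closed_closure.
- by move=> t /sub [/s1|/s2].
Qed.

Lemma test_function0 : test_function (fun _ : R => 0).
Proof.
split.
- by move=> t; exact: derivable_cst.
- rewrite (_ : derive1 _ = fun=> 0); first by move=> ?; exact: cst_continuous.
  by apply/funext => t; rewrite derive1_cst.
- rewrite (_ : mkset _ = set0) ?closure0; first exact: compact0.
  by apply/seteqP; split => t //=; rewrite eqxx.
- rewrite (_ : mkset _ = set0) ?closure0 //.
  by apply/seteqP; split => t //=; rewrite eqxx.
Qed.

Lemma weak_derivativeE u g phi : is_weak_derivative u g -> test_function phi ->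
  ip u (derive1 phi) = - ip g phi.
Proof. by move=> [_ h] /h. Qed.

Lemma le0_of_geometric_bound (K x : R) : (forall m, x <= K * 4^-1 ^+ m) -> x <= 0.
Proof.
move=> h; have cv : geometric K 4^-1 @ \oo --> (0 : R).
  by apply: cvg_geometric; rewrite ger0_norm ?invr_ge0 // invf_lt1 // ltr1n.
by apply: (cvgr_to_ge cv); apply: nearW => m; exact: h.
Qed.

(** The concave functional whose supremum over the test functions is the energy
    [ip g g] of the weak derivative [g] of [u], without reference to [g]. *)
Definition energy_test u phi : R := - 2 * ip u (derive1 phi) - ip phi phi.

(** By the definition of the weak derivative,
    [energy_test u phi = ip g g - ip (g - phi) (g - phi)]. *)
Lemma energy_test_le u g phi : is_weak_derivative u g -> test_function phi ->
  energy_test u phi <= ip g g.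
Proof.
move=> hg hp; rewrite /energy_test (weak_derivativeE hg hp).
have Lg : L2_01 g by case: hg.
have := ip_ge0 (fun t => g t - phi t); rewrite ipB_sqr //; last exact: test_L2.
lra.
Qed.

Lemma energy_test_lincomb u phi psi (a b : R) : L2_01 u ->
  test_function phi -> test_function psi ->
  energy_test u (fun t => a * phi t + b * psi t) =
  - 2 * (a * ip u (derive1 phi) + b * ip u (derive1 psi))
  - (a ^+ 2 * ip phi phi + 2 * a * b * ip phi psi + b ^+ 2 * ip psi psi).
Proof.
move=> hu h1 h2; rewrite /energy_test derive1_lincomb //.
have [L1 L2] := (test_L2 h1, test_L2 h2).
have [D1 D2] := (test_derive_L2 h1, test_derive_L2 h2).
rewrite ipDr ?ipZr //; try exact: L2_01Z.
rewrite ipD_sqr ?ipZr ?ipZl //; try exact: L2_01Z.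
move: (ip u _) (ip u _) (ip phi phi) (ip phi psi) (ip psi psi) => ? ? ? ? ?.
ring.
Qed.

(** [energy_test u] is a concave quadratic functional, uniformly concave in the L^2
    norm: at the midpoint of two test functions it exceeds the mean of its values
    by a quarter of their squared distance.  Hence a maximizing sequence is Cauchy,
    and the Euler-Lagrange equation at its limit says that the limit is a weak
    derivative of [u]. *)
Lemma weak_derivative_of_energy_bound u (M : R) : L2_01 u ->
  (forall phi, test_function phi -> energy_test u phi <= M) ->
  exists2 g, is_weak_derivative u g & ip g g <= M.
Proof.
move=> hu hM.
pose S := [set energy_test u phi | phi in @test_function R].
have Sub : has_sup S.
  split; first by exists (energy_test u (fun=> 0)); exists (fun=> 0) => //; exact: test_function0.
  by exists M => _ [phi hp <-]; exact: hM.
pose s := sup S.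
have es phi : test_function phi -> energy_test u phi <= s.
  by move=> hp; apply: sup_upper_bound => //; exists phi.
have sM : s <= M by apply: ge_sup => [|_ [phi hp <-]]; [case: Sub|exact: hM].
(* The factor [4^-1] cancels the constant of the parallelogram identity, so that
   the sequence is Cauchy at exactly the rate asked by [L2_complete]. *)
pose eps m : R := 4^-1 * 4^-1 ^+ m.
have eps0 m : 0 < eps m by rewrite mulr_gt0 // exprn_gt0.
have /choice[phi hphi] m : exists phi, test_function phi /\ s - eps m < energy_test u phi.
  by have [_ [phi hp <-] h] := sup_adherent (eps0 m) Sub; exists phi.
have tphi m : test_function (phi m) by have [] := hphi m.
have Lphi m := test_L2 (tphi m).
have cau m l : (m <= l)%N ->
    ip (fun t => phi l t - phi m t) (fun t => phi l t - phi m t) <= 4^-1 ^+ m.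
  move=> ml; have := es _ (test_lincomb 2^-1 2^-1 (tphi m) (tphi l)).
  rewrite energy_test_lincomb // ipB_sqr // (ipC (phi l) (phi m)).
  have [_] := hphi m; have [_] := hphi l; rewrite /energy_test.
  have : eps l <= eps m.
    rewrite /eps ler_wpM2l // ler_wiXn2l //; lra.
  rewrite /eps.
  move: (ip u _) (ip u _) (ip (phi m) _) (ip (phi m) _) (ip (phi l) _) => ? ? ? ? ?.
  lra.
have [g Lg hg] := L2_complete Lphi cau.
have wg : is_weak_derivative u g.
  split=> // psi tpsi; rewrite -!/(ip _ _).
  have Lpsi := test_L2 tpsi.
  suff : (ip u (derive1 psi) + ip g psi) ^+ 2 <= 0.
    by rewrite real_exprn_even_le0 ?num_real //= addr_eq0 => /eqP.
  apply: (@le0_of_geometric_bound (4 * ip psi psi)) => m.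
  set c := ip u (derive1 psi); set D := ip g psi; set P := ip psi psi.
  pose d := ip (phi m) psi.
  (* [phi m] is within [eps m] of the supremum, so along [phi m + r psi] the
     functional gains at most [eps m]; the discriminant bounds its slope. *)
  have h1 : (c + d) ^+ 2 <= P * eps m.
    apply: sqr_le_of_quadratic_ge0; first exact: ip_ge0.
    move=> r; have := es _ (test_lincomb 1 r (tphi m) tpsi).
    rewrite energy_test_lincomb //; have [_] := hphi m; rewrite /energy_test.
    rewrite -/c -/d -/P.
    move: (ip u _) (ip (phi m) (phi m)) c d P (eps m) => ? ? ? ? ? ?.
    lra.
  have h2 : (D - d) ^+ 2 <= 4^-1 ^+ m * P.
    rewrite /D /d -ipBl //; apply: le_trans (ip_cauchy_schwarz _ _) _ => //.
      exact: L2_01B.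
    by rewrite ler_wpM2r // ip_ge0.
  have P0 : 0 <= P := ip_ge0 _.
  have h3 : P * eps m <= P * 4^-1 ^+ m.
    rewrite ler_wpM2l // /eps.
    have : 0 <= 4^-1 ^+ m :> R by rewrite exprn_ge0.
    by move: (4^-1 ^+ m) => ?; lra.
  have := sqr_ge0 (c + d - (D - d)).
  move: c d D P (eps m) (4^-1 ^+ m) {P0} h1 h2 h3 => ? ? ? ? ? ?; nra.
exists g => //; apply: le_trans sM.
rewrite -subr_le0; apply: (@le0_of_geometric_bound 1) => m.
have := es _ (tphi m); rewrite /energy_test (weak_derivativeE wg (tphi m)).
have := hg m; rewrite ipB_sqr // mul1r.
move: (ip g _) (ip g _) (ip (phi m) _) (4^-1 ^+ m) => ? ? ? ?; lra.
Qed.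

End weak_derivative.

(** * Smoothed indicator functions and the Hoelder estimate *)

Section ramps.
Context (R : realType).
Local Notation mu := (@lebesgue_measure R).
Implicit Types (u v w f g phi psi : R -> R).

Definition C1 f := (forall t, derivable f t 1) /\ continuous (derive1 f).

Lemma C1_is_derive f f' : (forall t, is_derive t (1 : R) f (f' t)) -> continuous f' -> C1 f.
Proof.
move=> h c; split; first by move=> t; have [] := h t.
by have -> : derive1 f = f' by apply/funext => t; rewrite derive1E; exact: derive_val.
Qed.

Lemma C1_continuous f : C1 f -> continuous f.
Proof. by move=> [d _] x; apply/differentiable_continuous/derivable1_diffP. Qed.

Lemma C1_L2 f : C1 f -> L2_01 f.
Proof. by move=> /C1_continuous/continuous_within01/L2_01_continuous. Qed.

Lemma C1_derive_L2 f : C1 f -> L2_01 (derive1 f).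
Proof. by move=> [_ c]; exact/L2_01_continuous/continuous_within01. Qed.

Lemma test_C1 phi : test_function phi -> C1 phi.
Proof. by case. Qed.

Lemma ip_by_parts u v : C1 u -> C1 v ->
  ip u (derive1 v) = u 1 * v 1 - u 0 * v 0 - ip (derive1 u) v.
Proof.
move=> hu hv; have [[du cu] [dv cv]] := (hu, hv).
have [ku kv] := (C1_continuous hu, C1_continuous hv).
have LR w : C1 w -> derivable_oo_LRcontinuous w 0 1.
  move=> hw; split; first by move=> x _; exact: hw.1.
    by apply: cvg_at_right_filter; exact: C1_continuous.
  by apply: cvg_at_left_filter; exact: C1_continuous.
have E w z : continuous w -> continuous z ->
    ip w z = \int[mu]_(t in `[0, 1]) (w t * z t).
  move=> cw cz; rewrite /ip.
  have ci : {within `[0, 1], continuous (fun t => w t * z t)}.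
    by apply: continuous_within01 => x; apply: cvgM; [exact: cw|exact: cz].
  rewrite -Rintegral_itv_obnd_cbnd; last first.
    apply: (@integrableS _ _ _ mu `[0, 1]%classic) => //.
      exact: subset_itv_oc_cc.
    by apply: continuous_compact_integrable => //; exact: segment_compact.
  by rewrite Rintegral_itv_bndo_bndc //; exact: integrable_continuous_oo01.
rewrite (E _ _ ku cv) (E _ _ cu kv).
apply: (Rintegration_by_parts ltr01).
- exact: (continuous_within01 cu).
- exact: LR.
- by [].
- exact: (continuous_within01 cv).
- exact: LR.
- by [].
Qed.

(** The square of the positive part has the 2-Lipschitz derivative
    [2 * Num.max x 0]; one uniform remainder estimate avoids treating the
    junction at 0 separately. *)
Lemma quadratic_remainder (x h : R) :
  `|Num.max (x + h) 0 ^+ 2 - Num.max x 0 ^+ 2 - h * (2 * Num.max x 0)| <= h ^+ 2.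
Proof.
have [h1|h1] := leP (x + h) 0; have [h2|h2] := leP x 0.
- rewrite expr0n /= mulr0 mulr0 !subr0 normr0 sqr_ge0 //.
- have a0 : 0 <= - (x + h) * x by rewrite mulr_ge0 //; lra.
  have := sqr_ge0 h; have := sqr_ge0 x; have := sqr_ge0 (x + h).
  by rewrite expr0n /= sub0r ler_norml !expr2 => *; apply/andP; split; lra.
- rewrite expr0n /= mulr0 mulr0 !subr0 ger0_norm ?sqr_ge0 // ler_sqr ?nnegrE; lra.
- rewrite (_ : _ - _ = h ^+ 2); last by ring.
  by rewrite ger0_norm ?sqr_ge0.
Qed.
Lemma is_derive_sqr_pos (x : R) :
  is_derive x 1 (fun t => Num.max t 0 ^+ 2) (2 * Num.max x 0).
Proof.
have cv : h^-1 *: (Num.max (h *: 1 + x) 0 ^+ 2 - Num.max x 0 ^+ 2) @[h --> 0^'] -->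
    2 * Num.max x 0.
  apply/cvgrPdist_le => e e0; near=> h.
  have h0 : h != 0 by near: h; exact: nbhs_dnbhs_neq.
  have he : `|h| <= e by near: h; exact: dnbhs0_le.
  rewrite distrC /GRing.scale /= mulr1 (addrC h).
  have -> : h^-1 * (Num.max (x + h) 0 ^+ 2 - Num.max x 0 ^+ 2) - 2 * Num.max x 0 =
      h^-1 * (Num.max (x + h) 0 ^+ 2 - Num.max x 0 ^+ 2 - h * (2 * Num.max x 0)).
    by field.
  rewrite normrM normfV ler_pdivrMl ?normr_gt0 //.
  apply: le_trans (quadratic_remainder x h) _.
  by rewrite -real_normK ?num_real // expr2 ler_wpM2l.
apply: DeriveDef; first by apply/cvg_ex; exists (2 * Num.max x 0).
exact/cvg_lim.
Unshelve. all: by end_near. Qed.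

(** The C^1 quadratic spline from 0 to 1 on [[0, 1]] with knots 0, 1/2 and 1. *)
Definition smoothstep (x : R) : R :=
  2 * Num.max x 0 ^+ 2 - 4 * Num.max (x - 2^-1) 0 ^+ 2 + 2 * Num.max (x - 1) 0 ^+ 2.

(** The derivative of [smoothstep]: the tent function of mass 1. *)
Definition hat (x : R) : R :=
  4 * (Num.max x 0 - 2 * Num.max (x - 2^-1) 0 + Num.max (x - 1) 0).

Lemma smoothstep_le0 x : x <= 0 -> smoothstep x = 0.
Proof.
move=> h; rewrite /smoothstep !max_r; [ring|lra..].
Qed.

Lemma smoothstep_ge1 x : 1 <= x -> smoothstep x = 1.
Proof.
move=> h; rewrite /smoothstep !max_l; [lra|lra..].
Qed.

Lemma smoothstep_itv x : 0 <= smoothstep x <= 1.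
Proof.
have [h|h] := leP x 0; first by rewrite smoothstep_le0 // lexx ler01.
have [h1|h1] := leP 1 x; first by rewrite smoothstep_ge1 // lexx ler01.
rewrite /smoothstep (max_l (ltW h)) [Num.max (x - 1) 0]max_r; last lra.
have [h2|h2] := leP (x - 2^-1) 0.
  by rewrite !expr2 !mul0r; apply/andP; split; nra.
by rewrite !expr2; apply/andP; split; nra.
Qed.

Lemma hat_ge0 x : 0 <= hat x.
Proof.
rewrite /hat.
have [h1|h1] := leP x 0; have [h2|h2] := leP (x - 2^-1) 0; have [h3|h3] := leP (x - 1) 0;
  lra.
Qed.

Lemma hat_out x : x <= 0 \/ 1 <= x -> hat x = 0.
Proof.
move=> [h|h]; rewrite /hat; first by rewrite !max_r; [ring|lra..].
rewrite !max_l; lra.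
Qed.

Lemma continuous_pos (c : R) : continuous (fun x : R => Num.max (x - c) 0).
Proof.
have -> : (fun x : R => Num.max (x - c) 0) = (fun x => (x - c + `|x - c|) / 2).
  by apply/funext => x; rewrite maxr_absE !subr0 addr0.
have cB : continuous (fun x : R => x - c).
  by move=> x; apply: cvgB; [exact: cvg_id|exact: cvg_cst].
move=> x; apply: cvgM; last exact: cvg_cst.
by apply: cvgD; [exact: cB|apply: cvg_norm; exact: cB].
Qed.

Lemma continuous_hat : continuous hat.
Proof.
have c0 : continuous (fun x : R => Num.max x 0).
  by have := @continuous_pos 0; under eq_fun do rewrite subr0.
move=> x; apply: cvgM; first exact: cvg_cst.
apply: cvgD; last exact: continuous_pos.
apply: cvgB; first exact: c0.
by apply: cvgM; [exact: cvg_cst|exact: continuous_pos].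
Qed.

Lemma is_derive_affine_comp (f : R -> R) (f' c d t : R) :
  is_derive ((t - c) / d) (1 : R) f f' ->
  is_derive t (1 : R) (fun x => f ((x - c) / d)) (f' / d).
Proof.
move=> h.
have ha : is_derive t (1 : R) (fun x : R => (x - c) / d) (d^-1).
  have -> : (fun x : R => (x - c) / d) = (d^-1 \*: (id - cst c)).
    by apply/funext => x; rewrite /= mulrC.
  have := is_deriveZ d^-1 (is_deriveB (is_derive_id t (1 : R)) (is_derive_cst c t (1 : R))).
  by rewrite subr0 /GRing.scale /= mulr1.
have := @is_derive1_comp _ f (fun x => (x - c) / d) t _ _ h ha.
by [].
Qed.

Lemma is_derive_smoothstep x : is_derive x (1 : R) smoothstep (hat x).
Proof.
have hB c : is_derive x (1 : R) (fun t => Num.max (t - c) 0 ^+ 2) (2 * Num.max (x - c) 0).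
  have := @is_derive_affine_comp (fun t => Num.max t 0 ^+ 2) (2 * Num.max (x - c) 0) c 1 x.
  rewrite !divr1 => /(_ (is_derive_sqr_pos _)).
  by under eq_fun do rewrite divr1.
have h := is_deriveD (is_deriveB (is_deriveZ 2 (is_derive_sqr_pos x))
  (is_deriveZ 4 (hB 2^-1))) (is_deriveZ 2 (hB 1)).
apply: (is_derive_eq h); rewrite /hat /GRing.scale /=.
move: (Num.max x 0) (Num.max (x - _) 0) (Num.max (x - _) 0) => ? ? ?; ring.
Qed.

Definition ramp (a e t : R) : R := smoothstep ((t - a) / e).

Lemma is_derive_ramp a e t : is_derive t (1 : R) (ramp a e) (hat ((t - a) / e) / e).
Proof. exact: (is_derive_affine_comp (is_derive_smoothstep _)). Qed.

Lemma ramp_derive a e : derive1 (ramp a e) = (fun t => hat ((t - a) / e) / e).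
Proof.
by apply/funext => t; rewrite derive1E; have h := is_derive_ramp a e t; exact: derive_val.
Qed.

Lemma ramp_C1 a e : C1 (ramp a e).
Proof.
apply: (C1_is_derive (is_derive_ramp a e)) => t.
apply: cvgM; last exact: cvg_cst.
apply: (@continuous_comp _ _ _ (fun t => (t - a) / e) hat); last exact: continuous_hat.
apply: cvgM; last exact: cvg_cst.
by apply: cvgB; [exact: cvg_id|exact: cvg_cst].
Qed.

Lemma ramp_le a e t : 0 < e -> t <= a -> ramp a e t = 0.
Proof.
move=> e0 ta; apply: smoothstep_le0.
by apply: mulr_le0_ge0; rewrite ?subr_le0 // invr_ge0 ltW.
Qed.

Lemma ramp_ge a e t : 0 < e -> a + e <= t -> ramp a e t = 1.
Proof.
by move=> e0 ta; apply: smoothstep_ge1; rewrite ler_pdivlMr // mul1r lerBrDl.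
Qed.

Lemma ramp_itv a e t : 0 <= ramp a e t <= 1.
Proof. exact: smoothstep_itv. Qed.

Lemma ramp_derive_ge0 a e t : 0 < e -> 0 <= derive1 (ramp a e) t.
Proof. by move=> e0; rewrite ramp_derive divr_ge0 ?hat_ge0 // ltW. Qed.

Lemma ramp_derive_out a e t : 0 < e -> t <= a \/ a + e <= t -> derive1 (ramp a e) t = 0.
Proof.
move=> e0 h; rewrite ramp_derive hat_out ?mul0r //; case: h => h; [left|right].
  by apply: mulr_le0_ge0; rewrite ?subr_le0 // invr_ge0 ltW.
by rewrite ler_pdivlMr // mul1r lerBrDl.
Qed.

Lemma C1_cst (c : R) : C1 (fun=> c).
Proof.
by apply: (@C1_is_derive _ (fun=> 0)) => ?; exact: cvg_cst.
Qed.

Lemma C1_id : C1 id.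
Proof.
by apply: (@C1_is_derive _ (fun=> 1)) => ?; exact: cvg_cst.
Qed.

Lemma ip0l u : ip (fun=> 0) u = 0.
Proof.
transitivity (ip (fun=> 0 : R) (fun=> 0)); last by rewrite ip_cst mul0r.
by apply: eq_Rintegral => t _; rewrite !mul0r.
Qed.

Lemma ip_ramp_mass a e : 0 < e -> 0 <= a -> a + e <= 1 ->
  ip (fun=> 1) (derive1 (ramp a e)) = 1.
Proof.
move=> e0 a0 ae1; rewrite ip_by_parts; [|exact: C1_cst|exact: ramp_C1].
have -> : derive1 (fun=> 1 : R) = (fun=> 0 : R).
  by apply/funext => t; rewrite derive1_cst.
by rewrite ramp_ge // ramp_le // ip0l; ring.
Qed.

(** The derivative of a ramp is a nonnegative kernel of mass 1 carried by
    [[a, a + e]], so pairing with it averages [u] there. *)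
Lemma ip_ramp_average u (a e c d : R) : 0 < e -> 0 <= a -> a + e <= 1 ->
  L2_01 u -> (forall t, a <= t <= a + e -> `|u t - c| <= d) ->
  `|ip u (derive1 (ramp a e)) - c| <= d.
Proof.
move=> e0 a0 ae1 Lu hd.
have Lr := C1_derive_L2 (ramp_C1 a e).
have mass := ip_ramp_mass e0 a0 ae1.
have d0 : 0 <= d.
  by apply: le_trans (hd a _); rewrite ?normr_ge0 // lexx lerDl ltW.
have ptw t : `|(u t - c) * derive1 (ramp a e) t| <= d * derive1 (ramp a e) t.
  have [ta|ta] := leP t a.
    by rewrite ramp_derive_out ?mulr0 ?normr0 //; left.
  have [te|te] := leP (a + e) t.
    by rewrite ramp_derive_out ?mulr0 ?normr0 //; right.
  rewrite normrM (ger0_norm (ramp_derive_ge0 a t e0)) ler_wpM2r ?ramp_derive_ge0 //.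
  by apply: hd; rewrite !ltW.
have cE k : ip (fun=> k) (derive1 (ramp a e)) = k.
  have -> : (fun=> k) = (fun t : R => k * 1) by apply/funext => t; rewrite mulr1.
  by rewrite ipZl ?mass ?mulr1 //; exact: L2_01_cst.
have -> : ip u (derive1 (ramp a e)) - c = ip (fun t => u t - c) (derive1 (ramp a e)).
  by rewrite ipBl ?cE //; exact: L2_01_cst.
have Luc : L2_01 (fun t => u t - c) by apply: L2_01B => //; exact: L2_01_cst.
rewrite ler_norml; apply/andP; split.
  rewrite -(cE (- d)); apply: ip_le => //; first exact: L2_01_cst.
  by move=> t _; have := ptw t; rewrite ler_norml mulNr => /andP[].
rewrite -(cE d); apply: ip_le => //; first exact: L2_01_cst.
by move=> t _; have := ptw t; rewrite ler_norml => /andP[].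
Qed.

Lemma C1B f g : C1 f -> C1 g -> C1 (fun t => f t - g t).
Proof.
move=> [df cf] [dg cg].
apply: (@C1_is_derive _ (fun t => derive1 f t - derive1 g t)) => t.
  rewrite !derive1E; apply: is_deriveB; exact: DeriveDef.
by apply: cvgB; [exact: cf|exact: cg].
Qed.

Lemma derive1B_C1 f g : C1 f -> C1 g ->
  derive1 (fun t => f t - g t) = (fun t => derive1 f t - derive1 g t).
Proof.
by move=> [df cf] [dg cg]; apply/funext => t; rewrite !derive1E (deriveB (df t) (dg t)).
Qed.

Lemma C1_test_function f (a b : R) : C1 f -> 0 < a -> b < 1 ->
  (forall t, ~~ (a <= t <= b) -> f t = 0) -> test_function f.
Proof.
move=> [df cf] a0 b1 h.
have sub : closure [set t | f t != 0] `<=` `[a, b].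
  have cl : closed (`[a, b]%classic : set R) by exact: interval_closed.
  rewrite [X in _ `<=` X](proj1 (closure_id _) cl).
  apply: closureS => t /=; rewrite in_itv /=; apply: contra_neqT; exact: h.
split => //.
  by apply: (subclosed_compact _ (@segment_compact _ a b)) => //; exact: closed_closure.
move=> t /sub /=; rewrite !in_itv /= => /andP[h1 h2].
by rewrite (lt_le_trans a0 h1) (le_lt_trans h2 b1).
Qed.

(** The ramps are placed strictly inside [[s, t]], so that the bump is a test
    function of the open unit interval even when [s = 0] or [t = 1]. *)
Definition bump (s t e x : R) : R := ramp (s + e) e x - ramp (t - 2 * e) e x.

Lemma bump_in (s t e : R) (e0 : 0 < e) (es : 4 * e <= t - s) x :
  s + 2 * e <= x <= t - 2 * e -> bump s t e x = 1.
Proof.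
by move=> /andP[h1 h2]; rewrite /bump ramp_ge ?ramp_le ?subr0 //; lra.
Qed.

Lemma bump_out (s t e : R) (e0 : 0 < e) (es : 4 * e <= t - s) x :
  x <= s + e \/ t - e <= x -> bump s t e x = 0.
Proof.
move=> [h|h]; rewrite /bump; first by rewrite !ramp_le ?subrr //; lra.
by rewrite !ramp_ge ?subrr //; lra.
Qed.

Lemma bump_itv (s t e : R) (e0 : 0 < e) (es : 4 * e <= t - s) x :
  0 <= bump s t e x <= 1.
Proof.
rewrite /bump; have [h|h] := leP x (t - 2 * e).
  by rewrite (ramp_le _ h) // subr0 ramp_itv.
have := ramp_itv (t - 2 * e) e x.
by rewrite (@ramp_ge (s + e)) //; lra.
Qed.

Lemma bump_test (s t e : R)
    (s0 : 0 <= s) (t1 : t <= 1) (e0 : 0 < e) (es : 4 * e <= t - s) :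
  test_function (bump s t e).
Proof.
apply: (@C1_test_function _ (s + e) (t - e)); [|lra|lra|].
  by apply: C1B; exact: ramp_C1.
move=> x h; apply: (bump_out e0 es).
have [|h1] := leP x (s + e); first by left.
by right; rewrite leNgt; apply: contra h => h2; rewrite ltW //= ltW.
Qed.

Lemma bump_derive_average (s t e : R)
    (s0 : 0 <= s) (t1 : t <= 1) (e0 : 0 < e) (es : 4 * e <= t - s) u (d : R) :
  L2_01 u ->
  (forall x, s <= x <= s + 2 * e -> `|u x - u s| <= d) ->
  (forall x, t - 2 * e <= x <= t -> `|u x - u t| <= d) ->
  `|ip u (derive1 (bump s t e)) - (u s - u t)| <= 2 * d.
Proof.
move=> Lu hs ht; rewrite derive1B_C1; [|exact: ramp_C1|exact: ramp_C1].
rewrite ipBr //; try exact/C1_derive_L2/ramp_C1.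
have h1 : `|ip u (derive1 (ramp (s + e) e)) - u s| <= d.
  apply: ip_ramp_average => //; [lra|lra|] => x hx; apply: hs; lra.
have h2 : `|ip u (derive1 (ramp (t - 2 * e) e)) - u t| <= d.
  apply: ip_ramp_average => //; [lra|lra|] => x hx; apply: ht; lra.
move: (ip u _) (ip u _) h1 h2 => a b; rewrite !ler_norml => /andP[? ?] /andP[? ?].
apply/andP; split; lra.
Qed.

(** As [0 <= bump <= 1], its square integral is at most its integral, which by parts
    is minus the pairing of the identity with the derivative of the bump; this pairing
    averages the identity near [s] and near [t]. *)
Lemma bump_sqnorm (s t e : R)
    (s0 : 0 <= s) (t1 : t <= 1) (e0 : 0 < e) (es : 4 * e <= t - s) :
  ip (bump s t e) (bump s t e) <= t - s + 4 * e.
Proof.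
have Lb := test_L2 (bump_test s0 t1 e0 es).
apply: (@le_trans _ _ (ip (fun=> 1) (bump s t e))).
  apply: ip_le => //; first exact: L2_01_cst.
  by move=> x _; have /andP[h0 h1] := bump_itv e0 es x; rewrite ler_wpM2r.
have b0 x : x <= s + e \/ t - e <= x -> bump s t e x = 0 := @bump_out _ _ _ e0 es x.
have hp : ip id (derive1 (bump s t e)) = - ip (fun=> 1) (bump s t e).
  rewrite (ip_by_parts C1_id (test_C1 (bump_test s0 t1 e0 es))).
  have -> : derive1 (id : R -> R) = (fun=> 1) by apply/funext => x; rewrite derive1_id.
  by rewrite (b0 1) ?(b0 0); [rewrite mulr0 mul0r subrr sub0r|left; lra|right; lra].
have L2id : L2_01 (id : R -> R) by exact: C1_L2 C1_id.
have : `|ip id (derive1 (bump s t e)) - (s - t)| <= 2 * (2 * e).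
  by apply: bump_derive_average => // x hx /=; rewrite ler_norml; lra.
rewrite hp; move: (ip _ _) => a; rewrite ler_norml => /andP[? ?]; lra.
Qed.

Lemma within01_modulus u (s d : R) : {within `[0, 1], continuous u} ->
  0 <= s <= 1 -> 0 < d ->
  exists2 r : R, 0 < r & forall x, 0 <= x <= 1 -> `|x - s| < r -> `|u x - u s| <= d.
Proof.
move=> /subspace_continuousP cu s01 d0.
have /(_ _)/cvgrPdist_le/(_ _ d0) := cu s; rewrite /= in_itv /= => /(_ s01).
rewrite near_withinE => /nbhs_ballP[r r0 h]; exists r => // x x01 xs.
rewrite distrC; apply: h => /=; last by rewrite in_itv.
by rewrite /ball /= distrC.
Qed.

(** The limiting argument of the Hoelder estimate: [D] is the increment of the
    function, [y] its approximation by pairing with a bump, and the error terms are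
    linear in [d]. *)
Lemma sqr_le_of_approx (D E l e d y : R) : 0 <= E -> 0 <= D -> 0 <= l ->
  0 < d -> e <= d -> y ^+ 2 <= E * (l + 4 * e) -> D - 2 * d <= `|y| ->
  D ^+ 2 <= E * l + d * (4 * E + 4 * D).
Proof.
move=> E0 D0 l0 d0 ed hy hD.
have h4 : E * (l + 4 * e) <= E * l + 4 * d * E.
  by rewrite mulrDr lerD2l (mulrC (4 * d)) ler_wpM2l // ler_wpM2l.
have El0 : 0 <= E * l by rewrite mulr_ge0.
have dE0 : 0 <= d * E by rewrite mulr_ge0 // ltW.
have dD0 : 0 <= d * D by rewrite mulr_ge0 // ltW.
have [Dd|Dd] := leP D (2 * d).
  have : 0 <= (2 * d - D) * D by rewrite mulr_ge0 // subr_ge0.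
  by rewrite expr2; lra.
have h5 : (D - 2 * d) ^+ 2 <= y ^+ 2.
  by rewrite -[leRHS]real_normK ?num_real // ler_sqr ?nnegrE ?subr_ge0 ?(ltW Dd).
have : 0 <= d ^+ 2 by exact: sqr_ge0.
by rewrite !expr2 in h4 h5 hy *; lra.
Qed.

(** Pairing [u] with the derivative of a bump gives [u s - u t] up to a small error,
    while the pairing of [g] with the bump is at most
    [sqrt (ip g g) * sqrt (t - s + 4 * e)] by Cauchy-Schwarz.  The endpoints [0] and
    [1] are allowed, so that boundary values are controlled too. *)
Lemma holder_weak_derivative u g (s t : R) : {within `[0, 1], continuous u} ->
  is_weak_derivative u g -> 0 <= s -> s < t -> t <= 1 ->
  (u t - u s) ^+ 2 <= ip g g * (t - s).
Proof.
move=> cu wg s0 st t1.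
have Lu := L2_01_continuous cu.
have Lg : L2_01 g by case: wg.
pose D := `|u s - u t|; pose E := ip g g.
have E0 : 0 <= E := ip_ge0 g.
suff key d : 0 < d -> D ^+ 2 <= E * (t - s) + d * (4 * E + 4 * D).
  have -> : (u t - u s) ^+ 2 = D ^+ 2 by rewrite real_normK ?num_real //; ring.
  apply/ler_addgt0Pr => d d0.
  have K0 : 0 < 4 * E + 4 * D + 1 by have : 0 <= D := normr_ge0 _; lra.
  apply: le_trans (key (d / (4 * E + 4 * D + 1)) _) _; first by rewrite divr_gt0.
  rewrite lerD2l mulrAC ler_pdivrMr // ler_wpM2l ?ltW //; lra.
move=> d0.
have [e [e0 ed es hs ht]] : exists e, [/\ 0 < e, e <= d, 4 * e <= t - s,
    (forall x, s <= x <= s + 2 * e -> `|u x - u s| <= d) &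
    (forall x, t - 2 * e <= x <= t -> `|u x - u t| <= d)].
  have s01 : 0 <= s <= 1 by apply/andP; split; lra.
  have t01 : 0 <= t <= 1 by apply/andP; split; lra.
  have [r r0 hr] := within01_modulus cu s01 d0.
  have [q q0 hq] := within01_modulus cu t01 d0.
  pose e := Num.min (Num.min d ((t - s) / 4)) (Num.min (r / 4) (q / 4)).
  have [ed es er eq_] : [/\ e <= d, e <= (t - s) / 4, e <= r / 4 & e <= q / 4].
    by rewrite /e !ge_min !lexx ?orbT.
  have e0 : 0 < e by rewrite /e !lt_min d0 !divr_gt0 // subr_gt0.
  exists e; split => //; first lra.
    by move=> x /andP[? ?]; apply: hr; rewrite ?ltr_norml; apply/andP; split; lra.
  by move=> x /andP[? ?]; apply: hq; rewrite ?ltr_norml; apply/andP; split; lra.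
have T := bump_test s0 t1 e0 es.
have h1 := bump_derive_average s0 t1 e0 es Lu hs ht.
have h2 := bump_sqnorm s0 t1 e0 es.
have h3 : ip u (derive1 (bump s t e)) ^+ 2 <= E * (t - s + 4 * e).
  rewrite (weak_derivativeE wg T) sqrrN.
  apply: le_trans (ip_cauchy_schwarz Lg (test_L2 T)) _.
  by rewrite ler_wpM2l.
apply: (sqr_le_of_approx (y := ip u (derive1 (bump s t e))) E0 _ _ d0 ed h3).
- exact: normr_ge0.
- by rewrite subr_ge0 ltW.
have := lerB_dist (u s - u t) (ip u (derive1 (bump s t e))).
by rewrite distrC -/D; move: (ip u _) h1 => a; lra.
Qed.

End ramps.

(** * The energy does not depend on the choice of the weak derivative *)

Section fundamental_lemma.
Context (R : realType).
Local Notation mu := (@lebesgue_measure R).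
Implicit Types (u v w f g phi psi : R -> R).

Lemma L2_integrable f : L2_01 f -> mu.-integrable `]0, 1[ (EFin \o f).
Proof.
move=> Lf; apply: eq_integrable (L2_mul_integrable Lf (L2_01_cst 1)) => //.
by move=> t _ /=; rewrite mulr1.
Qed.

(** The bumps on [[0, t]] converge pointwise to the indicator function of the open
    interval as their ramps shrink; dominated convergence applies. *)
Lemma orthogonal_integral0 f (t : R) : L2_01 f ->
  (forall phi, test_function phi -> ip f phi = 0) -> 0 < t < 1 ->
  (\int[mu]_(x in `]0%R, t[) (f x)%:E = 0)%E.
Proof.
move=> Lf h /andP[t0 t1].
have mI : measurable (`]0, 1[%classic : set (measurableTypeR R)) by exact: measurable_itv.
have [mf _] := Lf.
pose e m : R := t / 4 / m.+1%:R.
have e0 m : 0 < e m by rewrite !divr_gt0.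
have et m : 4 * e m <= t - 0.
  rewrite subr0 /e mulrA (mulrC 4) divfK // ler_pdivrMr //.
  by apply: ler_peMr; [exact: ltW|rewrite ler1n].
pose b m := bump 0 t (e m).
have Tb m : test_function (b m) := bump_test (lexx 0) (ltW t1) (e0 m) (et m).
pose F m x := (f x * b m x)%:E.
pose L x := ((f \_ `]0, t[) x)%:E.
have mF m : measurable_fun (`]0, 1[%classic : set (measurableTypeR R)) (F m).
  by apply/measurable_EFinP; apply: measurable_funM => //; have [] := test_L2 (Tb m).
have mL : measurable_fun (`]0, 1[%classic : set (measurableTypeR R)) L.
  apply/measurable_EFinP; apply/measurable_restrict => //.
  by apply: measurable_funS mf => //; exact: subIsetl.
have lim x : `]0, 1[%classic x -> F ^~ x @ \oo --> L x.
  rewrite /= in_itv /= => /andP[x0 x1]; apply: cvg_EFin; first exact: nearW.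
  rewrite /= patchE; have [tx|xt] := leP t x.
    rewrite memNset; last by rewrite /= in_itv /= x0 /=; apply/negP; rewrite -leNgt.
    apply: cvg_near_cst; apply: nearW => m /=.
    by rewrite /b (bump_out (e0 m) (et m)) ?mulr0 //; right; have := e0 m; lra.
  rewrite mem_set; last by rewrite /= in_itv /= x0 xt.
  apply: cvg_near_cst.
  have ecv : e @ \oo --> 0.
    rewrite /e -[X in _ --> X](mulr0 (t / 4)).
    by apply: cvgM; [exact: cvg_cst|exact: cvg_harmonic].
  have : \forall m \near \oo, e m < Num.min (x / 2) ((t - x) / 2).
    apply: (cvgr_lt 0) => //; rewrite lt_min !divr_gt0 // subr_gt0 //.
  apply: filterS => m /=; rewrite lt_min => /andP[h1 h2].
  by rewrite /b (bump_in (e0 m) (et m)) ?mulr1 //; apply/andP; split; lra.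
have dom x m : `]0, 1[%classic x -> (`|F m x| <= `|(EFin \o f) x|)%E.
  move=> _; rewrite /F /= lee_fin normrM ler_piMr //.
  by have /andP[b0 b1] := bump_itv (e0 m) (et m) x; rewrite ger0_norm.
have [_ _] : [/\ mu.-integrable `]0, 1[ L,
    [sequence (\int[mu]_(x in `]0%R, 1%R[) `|F m x - L x|)%E]_m @ \oo --> 0%E &
    [sequence (\int[mu]_(x in `]0%R, 1%R[) F m x)%E]_m @ \oo -->
      (\int[mu]_(x in `]0%R, 1%R[) L x)%E].
  apply: (dominated_convergence _ mF mL _ (integrable_abse (L2_integrable Lf))) => //.
    by apply: aeW => x; exact: lim.
  by apply: aeW => x m; exact: dom.
have -> : [sequence (\int[mu]_(x in `]0%R, 1%R[) F m x)%E]_m = (fun=> 0%E).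
  apply/funext => m; transitivity (ip f (b m))%:E; last by rewrite (h _ (Tb m)).
  exact/esym/(ipE Lf (test_L2 (Tb m))).
move=> /cvg_lim => /(_ (@ereal_hausdorff _)).
rewrite lim_cst; last exact: ereal_hausdorff.
move=> L0; transitivity (\int[mu]_(x in `]0%R, 1%R[) L x)%E; last by rewrite -L0.
have -> : L = (EFin \o f) \_ `]0, t[ by rewrite restrict_EFin.
rewrite -integral_mkcondr.
congr (integral mu _ _); apply/seteqP; split => x /=; rewrite !in_itv /=.
  by move=> /andP[-> xt]; rewrite xt (lt_trans xt t1).
by move=> [].
Qed.

(** The primitive of [f] vanishes on the open unit interval, and by Lebesgue's
    theorem [f] is almost everywhere its derivative. *)
Lemma orthogonal_ae0 f : L2_01 f ->
  (forall phi, test_function phi -> ip f phi = 0) ->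
  {ae mu, forall t, `]0, 1[%classic t -> f t = 0}.
Proof.
move=> Lf h; have fi := L2_integrable Lf.
have mI : measurable (`]0, 1[%classic : set (measurableTypeR R)) by exact: measurable_itv.
pose f0 := f \_ `]0, 1[.
have f0i : mu.-integrable setT (EFin \o f0).
  by rewrite /f0 -restrict_EFin; apply/(integrable_mkcond _ mI).
pose F x := \int[mu]_(t in `]0, x]) f0 t.
have F0 x : 0 < x < 1 -> F x = 0.
  move=> x01; rewrite /F /Rintegral -integral_itv_bndo_bndc; last first.
    have /integrableP[m0 _] := f0i; apply/measurable_EFinP.
    by apply: measurable_funTS; exact/measurable_EFinP.
  transitivity (fine (\int[mu]_(t in `]0%R, x[) (f t)%:E)%E); last first.
    by rewrite orthogonal_integral0.
  congr fine; apply: eq_integral => t; rewrite inE /= in_itv /= => /andP[t0 tx].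
  rewrite /f0 patchE mem_set //= in_itv /= t0 (lt_trans tx) //.
  by case/andP: x01.
have fy y : mu.-integrable `]0, y] (EFin \o f0).
  by apply: (@integrableS _ _ _ mu setT) => //.
have := @FTC1 R f0 (BRight 0) fy (integrable_locally mI fi).
apply: filterS; first exact: (ae_filter_ringOfSetsType mu).
move=> t + t01; have := t01; rewrite /= in_itv /= => /andP[t0 t1].
have a0 : (BRight (0 : R) < BRight t)%O by rewrite bnd_simp.
move=> /(_ a0)[_]; rewrite /f0 patchE mem_set // => <-.
rewrite derive1E (@near_eq_derive _ _ _ _ (cst 0)) ?derive_cst //.
have : \forall x \near t, x \in `]0, 1[ by exact: near_in_itvoo.
by apply: filterS => x; rewrite in_itv /=; exact: F0.
Qed.

Lemma weak_derivative_unique_energy u g g' : is_weak_derivative u g ->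
  is_weak_derivative u g' -> ip g g = ip g' g'.
Proof.
move=> wg wg'; have Lg : L2_01 g by case: wg.
have Lg' : L2_01 g' by case: wg'.
have LB := L2_01B Lg Lg'.
have ae0 : {ae mu, forall t, `]0, 1[%classic t -> g t - g' t = 0}.
  apply: orthogonal_ae0 => // phi tphi.
  rewrite ipBl //; last exact: test_L2.
  have := weak_derivativeE wg tphi; rewrite (weak_derivativeE wg' tphi).
  by move=> /oppr_inj ->; rewrite subrr.
rewrite /ip /Rintegral; congr fine; apply: ae_eq_integral => //.
- by have /integrableP[] := L2_mul_integrable Lg Lg.
- by have /integrableP[] := L2_mul_integrable Lg' Lg'.
move: ae0; apply: filterS; first exact: (ae_filter_ringOfSetsType mu).
by move=> t h /h /subr0_eq ->.
Qed.

(** The bound holds for the weak derivative that is built from it, and therefore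
    for every weak derivative, in particular for a chosen one. *)
Lemma weak_derivative_energy_bound u g (M : R) : L2_01 u -> is_weak_derivative u g ->
  (forall phi, test_function phi -> energy_test u phi <= M) -> ip g g <= M.
Proof.
move=> Lu wg /(weak_derivative_of_energy_bound Lu)[g' wg'].
by rewrite (weak_derivative_unique_energy wg wg').
Qed.

End fundamental_lemma.

(** * Curves and their action *)

Section curves.
Context (R : realType) (n : nat).
Local Notation mu := (@lebesgue_measure R).
Implicit Types (x y : R -> 'rV[R]_n) (V : 'rV[R]_n -> R).

Lemma cvg_rV (T : Type) (F : set_system T) (FF : Filter F) (f : T -> 'rV[R]_n)
    (l : 'rV[R]_n) :
  (forall i, f t 0 i @[t --> F] --> l 0 i) -> f @ F --> l.
Proof.
move=> h A [P hP PA]; rewrite nbhs_simpl.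
have : \forall t \near F, forall i, P 0 i (f t 0 i).
  by apply: filter_forall => i; apply: h; exact: hP.
apply: filterS => t ht; apply: PA => i j; rewrite ord1; exact: ht.
Qed.

Lemma within_continuous_rV x :
  (forall i, {within `[0, 1], continuous (fun t => x t 0 i)}) ->
  {within `[0, 1], continuous x}.
Proof.
move=> h; apply/subspace_continuousP => t t01; apply: cvg_rV => i.
by have /subspace_continuousP := h i; exact.
Qed.

Lemma test_function_out (phi : R -> R) t : test_function phi -> ~~ (0 < t < 1) -> phi t = 0.
Proof.
move=> [_ _ _ h] tN; apply/eqP; apply: contraNT tN => pt.
by have := h t (@subset_closure _ [set t | phi t != 0] t pt); rewrite /= in_itv.
Qed.

Lemma C1_weak_derivative (u : R -> R) : C1 u -> is_weak_derivative u (derive1 u).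
Proof.
move=> cu; split; first exact: C1_derive_L2.
move=> phi tphi; have := ip_by_parts cu (test_C1 tphi); rewrite /ip => ->.
rewrite !(test_function_out tphi) ?ltxx ?andbF //.
by rewrite !mulr0 subrr sub0r.
Qed.

Lemma C1_affine (a b : R) : C1 (fun t => a + t * b).
Proof.
apply: (@C1_is_derive _ _ (fun=> b)); last by move=> ?; exact: cvg_cst.
move=> t; have h := is_deriveD (is_derive_cst a t (1 : R)) (is_deriveZ b (is_derive_id t (1 : R))).
have -> : (fun t : R => a + t * b) = (cst a + b \*: id).
  by apply/funext => s; rewrite /= /GRing.scale /= mulrC.
by apply: (is_derive_eq h); rewrite add0r /GRing.scale /= mulr1.
Qed.

(** The straight segment is a competitor. *)
Lemma W12_between_neq0 (xm xp : 'rV[R]_n) : W12_between xm xp !=set0.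
Proof.
pose x t := \row_i (xm 0 i + t * (xp 0 i - xm 0 i)) : 'rV[R]_n.
have xE i : (fun t => x t 0 i) = (fun t => xm 0 i + t * (xp 0 i - xm 0 i)).
  by apply/funext => t; rewrite mxE.
have c1 i : C1 (fun t => x t 0 i) by rewrite xE; exact: C1_affine.
exists x; split; last 2 first.
- by apply/rowP => i; rewrite mxE mul0r addr0.
- by apply/rowP => i; rewrite mxE mul1r addrC subrK.
split; [|by move=> i; exact: C1_L2|].
  by apply: within_continuous_rV => i; apply: continuous_within01; exact: C1_continuous.
exists (fun t => \row_i derive1 (fun t => x t 0 i) t) => i.
have -> : (fun t => (\row_i derive1 (fun t => x t 0 i) t) 0 i) = derive1 (fun t => x t 0 i).
  by apply/funext => t; rewrite mxE.
exact: C1_weak_derivative.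
Qed.

Lemma class_C_continuous m (f : 'rV[R]_n -> R) : class_C m f -> continuous f.
Proof. by case: m => [|m] //= []. Qed.

Lemma continuous_effective_potential sigma V :
  class_C 4 V -> continuous (effective_potential sigma V).
Proof.
move=> [_ h1].
have c1 i : continuous (partial i V) by have [_ h] := h1 i; exact: (@class_C_continuous 3 _ h).
have c2 i : continuous (partial i (partial i V)).
  by have [_ [_ h2]] := h1 i; have [_ h] := h2 i; exact: (@class_C_continuous 2 _ h).
have cl : continuous (laplacian V).
  by apply: continuous_big => [|i _]; [exact: add_continuous|exact: c2].
have cg : continuous (fun z : 'rV[R]_n => sqnorm (grad V z)).
  have -> : (fun z : 'rV[R]_n => sqnorm (grad V z)) =
      (fun z => \sum_(i < n) (partial i V z * partial i V z)).
    by apply/funext => z; apply: eq_bigr => i _; rewrite mxE expr2.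
  apply: continuous_big => [|i _ z]; first exact: add_continuous.
  exact: (cvgM (c1 i z) (c1 i z)).
by move=> x; exact: (cvgB (cvgM (cvg_cst _) (cl x)) (cvgM (cvg_cst _) (cg x))).
Qed.

(** For the constant curve at [z] on [[0, 1]] the Lagrangian action with constant [k']
    is [k' - U(z)], so every admissible [k'] dominates [U]; the definition of the
    infimum gives an admissible [k'] below [k]. *)
Lemma potential_gap sigma V (k : R) :
  (mane_critical_value (lagrangian sigma V) < k%:E)%E ->
  exists2 d : R, 0 < d & forall z, d <= k - effective_potential sigma V z.
Proof.
move=> /ereal_inf_lt[_ [k' hk' <-]]; rewrite lte_fin => kk'.
exists (k - k'); first by rewrite subr_gt0.
move=> z; rewrite lerD2l lerN2 -subr_ge0.
have ac : absolutely_continuous 0 1 (cst z).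
  move=> e e0; exists 1 => // N s t _ _ _.
  by under eq_bigr do rewrite /= subrr normr0; rewrite big1_eq.
have := hk' 1 (cst z) ltr01 ac.
have -> : (fun t => (lagrangian sigma V (cst z t) (derive1 (cst z) t) + k')%:E) =
    cst (k' - effective_potential sigma V z)%:E.
  apply/funext => t; rewrite /= derive1_cst /lagrangian; congr EFin.
  rewrite /sqnorm big1; first by rewrite mulr0 sub0r addrC.
  by move=> i _; rewrite mxE expr0n.
rewrite integral_cst //= lebesgue_measure_itv /= lte_fin ltr01 oppr0 adde0 mule1.
by rewrite lee_fin.
Qed.

Lemma integral_sumr (I : Type) (r : seq I) (F : I -> R -> R) :
  (forall i, mu.-integrable `]0, 1[ (EFin \o F i)) ->
  mu.-integrable `]0, 1[ (EFin \o (fun t => \sum_(i <- r) F i t)) /\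
  \int[mu]_(t in `]0, 1[) (\sum_(i <- r) F i t) =
  \sum_(i <- r) \int[mu]_(t in `]0, 1[) F i t.
Proof.
move=> h; elim: r => [|i r [IH1 IH2]].
  rewrite big_nil.
  have -> : (fun t => \sum_(i <- [::]) F i t) = (fun=> 0) :> (R -> R).
    by apply/funext => t; rewrite big_nil.
  split; first by have := L2_integrable (L2_01_cst (0 : R)).
  by rewrite Rintegral_cst // mul0r.
have -> : (fun t => \sum_(j <- i :: r) F j t) = (fun t => F i t + \sum_(j <- r) F j t).
  by apply/funext => t; rewrite big_cons.
split; first by have := integrableD _ (h i) IH1; apply.
by rewrite big_cons -IH2 RintegralD.
Qed.

Definition coord_energy x (i : 'I_n) : R :=
  ip (fun t => velocity x t 0 i) (fun t => velocity x t 0 i).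

Definition energy x : R := \sum_(i < n) coord_energy x i.

Lemma velocityP x : W12 x -> is_weak_velocity x (velocity x).
Proof. by move=> [_ _ h]; exact: (xgetPex _ h). Qed.

Lemma continuous_within_comp x (h : 'rV[R]_n -> R) : {within `[0, 1], continuous x} ->
  continuous h -> {within `[0, 1], continuous (h \o x)}.
Proof.
move=> /subspace_continuousP cx ch; apply/subspace_continuousP => t t01.
exact: (cvg_comp _ _ (cx t t01) (ch (x t))).
Qed.

(** Both integrals are finite for a curve in W^{1,2}, so the real-valued integral,
    which is 0 by convention when the integral diverges, can be split. *)
Lemma free_time_actionE sigma V k x T : continuous (effective_potential sigma V) ->
  W12 x -> 0 < T ->
  free_time_action (lagrangian sigma V) k x T =
  (2 * T)^-1 * energy x +
  T * \int[mu]_(t in `]0, 1[) (k - effective_potential sigma V (x t)).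
Proof.
move=> cU wx T0; have [cx _ _] := wx; have wv := velocityP wx.
pose U := effective_potential sigma V; pose v i t := velocity x t 0 i.
have Lv i : L2_01 (v i) by have [] := wv i.
have iW : mu.-integrable `]0, 1[ (EFin \o (fun t => k - U (x t))).
  apply: integrable_continuous_oo01.
  apply: (@continuous_within_comp x (fun z => k - U z)) => // z.
  exact: (cvgB (cvg_cst _) (cU z)).
have [iv iE] := integral_sumr (index_enum 'I_n) (fun i => L2_mul_integrable (Lv i) (Lv i)).
have GE t : lagrangian sigma V (x t) (T^-1 *: velocity x t) + k =
    (2 * T ^+ 2)^-1 * (\sum_(i < n) v i t * v i t) + (k - U (x t)).
  rewrite /lagrangian /sqnorm -addrA [- _ + k]addrC; congr (_ + _).
  rewrite !mulr_sumr; apply: eq_bigr => i _; rewrite mxE -/(v i t).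
  by field; rewrite gt_eqF.
have iG : mu.-integrable `]0, 1[
    (EFin \o (fun t => (2 * T ^+ 2)^-1 * (\sum_(i < n) v i t * v i t))).
  by have := integrableZl _ (2 * T ^+ 2)^-1 iv; apply.
rewrite /free_time_action.
have -> : \int[mu]_(t in `[0, 1]) (lagrangian sigma V (x t) (T^-1 *: velocity x t) + k) =
   \int[mu]_(t in `]0, 1[)
     ((2 * T ^+ 2)^-1 * (\sum_(i < n) v i t * v i t) + (k - U (x t))).
  under eq_Rintegral do rewrite GE.
  rewrite /Rintegral; congr fine; apply: integral_itv_bndoo.
  by have := integrableD _ iG iW => /(_ (measurable_itv _))/integrableP[].
have E1 : \int[mu]_(t in `]0, 1[) ((2 * T ^+ 2)^-1 * (\sum_(i < n) v i t * v i t)) =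
    (2 * T ^+ 2)^-1 * energy x.
  transitivity ((2 * T ^+ 2)^-1 * \int[mu]_(t in `]0, 1[) (\sum_(i < n) v i t * v i t)).
    exact: RintegralZl.
  by congr (_ * _); exact: iE.
transitivity (T * ((2 * T ^+ 2)^-1 * energy x + \int[mu]_(t in `]0, 1[) (k - U (x t)))).
  by congr (_ * _); rewrite -E1; exact: RintegralD.
rewrite mulrDr mulrA; congr (_ * _ + _).
by field; rewrite gt_eqF.
Qed.

End curves.

(** * Limits of curves of bounded energy *)

Section compactness.
Context (R : realType) (n : nat).
Local Notation mu := (@lebesgue_measure R).
Implicit Types (x : R -> 'rV[R]_n) (y : nat -> R -> 'rV[R]_n).

Lemma ultra_fmap (T T' : Type) (G : set_system T) (f : T -> T') :
  UltraFilter G -> UltraFilter (f @ G).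
Proof.
move=> GU; split; first exact: fmap_proper_filter.
move=> H HF sub; apply/seteqP; split; last exact: sub.
move=> A HA; have [//|GnA] := in_ultra_setVsetC (f @^-1` A) GU.
have HnA : H (~` A) by exact: sub.
by have [z []] := filter_ex (filterI HA HnA).
Qed.

(** Ultrafilters converge on compact sets, here on the segment [[l, r]]. *)
Lemma ultra_bounded_cvg (G : set_system nat) (a : nat -> R) (l r : R) :
  UltraFilter G -> (forall j, l <= a j <= r) ->
  exists2 b, l <= b <= r & a j @[j --> G] --> b.
Proof.
move=> GU h; have := @segment_compact R l r; rewrite compact_ultra.
move=> /(_ (a @ G) (ultra_fmap a GU)) []; last by move=> b [bM hb]; exists b.
change (G (a @^-1` `[l, r])); apply: filterE => j /=.
by rewrite in_itv /=; exact: h.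
Qed.

Lemma coord_holder x i s t : W12 x -> 0 <= s <= 1 -> 0 <= t <= 1 ->
  (x t 0 i - x s 0 i) ^+ 2 <= coord_energy x i * `|t - s|.
Proof.
move=> wx; have [cx _ _] := wx; have wv := velocityP wx i.
have ci : {within `[0, 1], continuous (fun t => x t 0 i)}.
  apply: (@continuous_within_comp R n x (fun z : 'rV[R]_n => z 0 i) cx).
  exact: coord_continuous.
wlog st : s t / s <= t => [hw s01 t01|/andP[s0 s1] /andP[t0 t1]].
  have [st|/ltW ts] := leP s t; first exact: hw.
  by rewrite -sqrrN opprB distrC; exact: hw.
move: st; rewrite le_eqVlt => /predU1P[->|st].
  by rewrite !subrr normr0 mulr0 expr0n.
rewrite ger0_norm ?subr_ge0 ?(ltW st) //.
exact: (holder_weak_derivative ci wv s0 st t1).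
Qed.

Lemma cvg_Rintegral_uniform (G : set_system nat) (FG : Filter G)
    (f : nat -> R -> R) (g : R -> R) :
  (forall j, {within `[0, 1], continuous (f j)}) -> {within `[0, 1], continuous g} ->
  (forall e, 0 < e -> \forall j \near G, forall t, 0 <= t <= 1 -> `|f j t - g t| <= e) ->
  \int[mu]_(t in `]0, 1[) f j t @[j --> G] --> \int[mu]_(t in `]0, 1[) g t.
Proof.
move=> cf cg h; apply/cvgrPdist_le => e e0; near=> j.
have hj : forall t, 0 <= t <= 1 -> `|f j t - g t| <= e by near: j; exact: h.
have ij := integrable_continuous_oo01 (cf j); have ig := integrable_continuous_oo01 cg.
rewrite -RintegralB //.
apply: le_trans (le_normr_Rintegral _ _) _ => //.
  by have := integrableB _ ig ij; apply.
apply: (@le_trans _ _ (\int[mu]_(t in `]0, 1[) e)); last first.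
  by rewrite -[leRHS]mulr1 -[leRHS](ip_cst e 1) /ip; under [leRHS]eq_Rintegral do rewrite mulr1.
apply: le_Rintegral => //.
- by have := integrable_norm (integrableB _ ig ij); apply.
- exact: L2_integrable (L2_01_cst e).
move=> t; rewrite /= in_itv /= => /andP[t0 t1]; rewrite distrC.
by apply: hj; rewrite !ltW.
Unshelve. all: by end_near. Qed.

Section limit.
Context (G : set_system nat) (GU : UltraFilter G) (y : nat -> R -> 'rV[R]_n).
Context (xm xp : 'rV[R]_n) (M : R).
Hypotheses (yW : forall j, W12_between xm xp (y j))
  (yM : forall j i, coord_energy (y j) i <= M).

Let wy j : W12 (y j). Proof. by have [] := yW j. Qed.

Let M0 (i : 'I_n) : 0 <= M.
Proof. exact: le_trans (ip_ge0 _) (yM 0%N i). Qed.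

Lemma equi_holder j i s t : 0 <= s <= 1 -> 0 <= t <= 1 ->
  (y j t 0 i - y j s 0 i) ^+ 2 <= M * `|t - s|.
Proof.
move=> s01 t01; apply: le_trans (coord_holder i (wy j) s01 t01) _.
by rewrite ler_wpM2r.
Qed.

(** At each time the coordinates stay in a fixed segment around [xm], by the Hoelder
    estimate from time 0. *)
Lemma pointwise_limit : exists x, forall t i, 0 <= t <= 1 ->
  y j t 0 i @[j --> G] --> x t 0 i.
Proof.
have ex t i : exists b : R, 0 <= t <= 1 -> y j t 0 i @[j --> G] --> b.
  have [t01|tN] := pselect (0 <= t <= 1); last by exists 0.
  have [|b _ hb] := @ultra_bounded_cvg G (fun j => y j t 0 i)
      (xm 0 i - (M + 1)) (xm 0 i + (M + 1)) GU; last by exists b.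
  move=> j; have z01 : 0 <= (0 : R) <= 1 by rewrite lexx ler01.
  have := equi_holder j i z01 t01; have [_ -> _] := yW j; rewrite subr0.
  case/andP: t01 => t0 t1; rewrite ger0_norm //.
  have : M * t <= M * 1 by rewrite ler_wpM2l // (M0 i).
  have := M0 i; move: (y j t 0 i) (xm 0 i) => a b M_0 h1 h2.
  have h3 : (a - b) ^+ 2 <= M by lra.
  by rewrite expr2 in h3; apply/andP; split; nra.
have /choice[f hf] (ti : R * 'I_n) := ex ti.1 ti.2.
exists (fun t => \row_i f (t, i)) => t i t01; rewrite mxE; exact: (hf (t, i)).
Qed.

Context (x : R -> 'rV[R]_n).
Hypothesis hx : forall t i, 0 <= t <= 1 -> y j t 0 i @[j --> G] --> x t 0 i.

Lemma limit_holder i s t : 0 <= s <= 1 -> 0 <= t <= 1 ->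
  (x t 0 i - x s 0 i) ^+ 2 <= M * `|t - s|.
Proof.
move=> s01 t01.
have cv : (y j t 0 i - y j s 0 i) * (y j t 0 i - y j s 0 i) @[j --> G] -->
    (x t 0 i - x s 0 i) * (x t 0 i - x s 0 i).
  by apply: cvgM; apply: cvgB; exact: hx.
rewrite expr2; apply: (cvgr_to_le cv); apply: nearW => j.
by rewrite -expr2; exact: equi_holder.
Qed.

Lemma norm_le_of_holder (a d e m : R) : 0 <= m -> 0 < e -> a ^+ 2 <= m * d ->
  d <= e ^+ 2 / (m + 1) -> `|a| <= e.
Proof.
move=> m0 e0 h1 h2; rewrite -ler_sqr ?nnegrE ?(ltW e0) // real_normK ?num_real //.
apply: le_trans h1 _; apply: le_trans (ler_wpM2l m0 h2) _.
rewrite mulrCA ler_piMr ?sqr_ge0 // ler_pdivrMr; first by rewrite mul1r lerDl.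
by rewrite ltr_wpDl.
Qed.

Lemma limit_continuous : {within `[0, 1], continuous x}.
Proof.
apply: within_continuous_rV => i; apply/subspace_continuousP => t t01.
have M_0 := M0 i.
apply/cvgrPdist_le => e e0; rewrite near_withinE; near=> s => s01.
rewrite distrC.
apply: (@norm_le_of_holder _ `|s - t| _ M) => //.
  by apply: limit_holder; move: s01 t01; rewrite /= !in_itv.
rewrite distrC ltW //; near: s; apply: (near_ball t).
by rewrite divr_gt0 ?exprn_gt0 // ltr_wpDl.
Unshelve. all: by end_near. Qed.

(** Equicontinuity makes [y j s] close to [x t] as soon as [s] is close to [t] and [j]
    is large; compactness of [[0, 1]] turns this local statement into a uniform one. *)
Lemma limit_uniform (h : 'rV[R]_n -> R) (e : R) : continuous h -> 0 < e ->
  \forall j \near G, forall t, 0 <= t <= 1 -> `|h (y j t) - h (x t)| <= e.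
Proof.
move=> ch e0.
have := @segment_compact R 0 1 => /compact_near_coveringP/near_covering_withinP.
move=> /(_ _ G (fun j t => `|h (y j t) - h (x t)| <= e) _) H.
have : \forall j \near G, `[0, 1]%classic `<=` (fun t => `|h (y j t) - h (x t)| <= e).
  apply: H => t t01.
  have t01' : 0 <= t <= 1 by move: t01; rewrite /= in_itv.
  have [P hP PN] : nbhs (x t) [set z | `|h (x t) - h z| <= e / 2].
    have e20 : 0 < e / 2 by rewrite divr_gt0.
    by have /cvgrPdist_le/(_ _ e20) := ch (x t).
  have near1 : \forall p \near filter_prod (nbhs t) G, forall i, 0 <= p.1 <= 1 -> P 0 i (y p.2 p.1 0 i).
    apply: filter_forall => i.
    have /nbhs_ballP[r r0 hr] := hP 0 i.
    have r20 : 0 < r / 2 by rewrite divr_gt0.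
    have M_0 := M0 i.
    exists (ball t ((r / 3) ^+ 2 / (M + 1)), [set j | `|x t 0 i - y j t 0 i| < r / 2]).
      split; last by have /cvgrPdist_lt/(_ _ r20) := @hx t i t01'.
      by apply: nbhsx_ballx; rewrite divr_gt0 ?exprn_gt0 ?divr_gt0 // ltr_wpDl.
    move=> [s j] [/= ts hj] s01; apply: hr; rewrite /ball /=.
    have : `|y j t 0 i - y j s 0 i| <= r / 3.
      apply: (norm_le_of_holder M_0 _ (equi_holder j i s01 t01')); first by rewrite divr_gt0.
      exact: ltW.
    move: hj; rewrite ltr_norml ler_norml ltr_norml => /andP[? ?] /andP[? ?].
    by apply/andP; split; lra.
  have near2 : \forall s \near t, 0 <= s <= 1 -> `|h (x t) - h (x s)| <= e / 2.
    have /subspace_continuousP/(_ t t01) := continuous_within_comp limit_continuous ch.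
    have e20 : 0 < e / 2 by rewrite divr_gt0.
    move=> /cvgrPdist_le/(_ _ e20); rewrite near_withinE.
    by apply: filterS => s hs s01; apply: hs; rewrite /= in_itv.
  have near2' : \forall p \near filter_prod (nbhs t) G, 0 <= p.1 <= 1 -> `|h (x t) - h (x p.1)| <= e / 2.
    by exists ([set s | 0 <= s <= 1 -> `|h (x t) - h (x s)| <= e / 2], setT);
      [split => //=; exact: filterT|move=> [s j] [/= hs _]].
  apply: filterS2 near1 near2' => -[s j] /= h1 h2; rewrite in_itv /= => s01.
  have h3 : `|h (x t) - h (y j s)| <= e / 2.
    by apply: PN => i' i; rewrite ord1; exact: h1.
  have := h2 s01; move: (h _) (h _) (h _) h3 => a b c; rewrite !ler_norml => *.
  by apply/andP; split; lra.
apply: filterS => j hj t t01; apply: hj; by rewrite /= in_itv.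
Qed.

Lemma limit_integral (h : 'rV[R]_n -> R) : continuous h ->
  \int[mu]_(t in `]0, 1[) h (y j t) @[j --> G] --> \int[mu]_(t in `]0, 1[) h (x t).
Proof.
move=> ch; apply: (@cvg_Rintegral_uniform G _ (fun j t => h (y j t)) (fun t => h (x t))); last first.
- by move=> e e0; exact: limit_uniform.
- exact: (continuous_within_comp limit_continuous ch).
- by move=> j; have [cy _ _] := wy j; exact: (continuous_within_comp cy ch).
Qed.

Lemma limit_energy_test i phi (c : R) : test_function phi ->
  coord_energy (y j) i @[j --> G] --> c ->
  energy_test (fun t => x t 0 i) phi <= c.
Proof.
move=> tphi hc.
have coordc : continuous (fun z : 'rV[R]_n => z 0 i) by exact: coord_continuous.
have cphi := continuous_within01 (test_C1 tphi).2.
have cv : ip (fun t => y j t 0 i) (derive1 phi) @[j --> G] -->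
    ip (fun t => x t 0 i) (derive1 phi).
  have [B B0 hB] : exists2 B, 0 < B & forall t, 0 <= t <= 1 -> `|derive1 phi t| <= B.
    have [t _ ht] := EVT_max ler01 (fun s => cvg_norm (cphi s)).
    exists (`|derive1 phi t| + 1); first by rewrite ltr_wpDl.
    by move=> s s01; apply: le_trans (ht s _) _; [rewrite in_itv|rewrite lerDl].
  have cM (z : R -> 'rV[R]_n) : {within `[0, 1], continuous z} ->
      {within `[0, 1], continuous (fun t => z t 0 i * derive1 phi t)}.
    move=> cz t; apply: cvgM; last exact: cphi.
    exact: (continuous_within_comp cz coordc).
  apply: (@cvg_Rintegral_uniform G _ (fun j t => y j t 0 i * derive1 phi t)
    (fun t => x t 0 i * derive1 phi t)).
  - by move=> j; apply: cM; have [] := wy j.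
  - exact: cM limit_continuous.
  move=> e e0; have eB : 0 < e / B by rewrite divr_gt0.
  apply: filterS (limit_uniform coordc eB) => j hj t t01.
  rewrite -mulrBl normrM -[leRHS](divfK (lt0r_neq0 B0)).
  by apply: ler_pM => //; [exact: hj|exact: hB].
have cv2 : energy_test (fun t => y j t 0 i) phi @[j --> G] -->
    energy_test (fun t => x t 0 i) phi.
  by apply: cvgB; [apply: cvgM => //; exact: cvg_cst|exact: cvg_cst].
apply: (ler_cvg_to cv2 hc); apply: nearW => j.
by apply: energy_test_le => //; exact: (velocityP (wy j)).
Qed.

(** Lower semicontinuity: the dual energy of each coordinate of the limit is bounded
    by the limit [c i] of the energies, so the limit has a weak derivative of energy
    at most [c i]. *)
Lemma limit_W12 (c : 'I_n -> R) :
  (forall i, coord_energy (y j) i @[j --> G] --> c i) ->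
  W12_between xm xp x /\ forall i, coord_energy x i <= c i.
Proof.
move=> hc.
have cx := limit_continuous.
have cxi i : {within `[0, 1], continuous (fun t => x t 0 i)}.
  apply: (@continuous_within_comp R n x (fun z : 'rV[R]_n => z 0 i) cx).
  exact: coord_continuous.
have Lx i := L2_01_continuous (cxi i).
have wx : W12 x.
  split => //.
  have ex i : exists g, is_weak_derivative (fun t => x t 0 i) g.
    have [g hg _] := weak_derivative_of_energy_bound (Lx i)
      (fun phi tphi => limit_energy_test tphi (hc i)).
    by exists g.
  have [g hg] := choice ex.
  exists (fun t => \row_i g i t) => i.
  by have -> : (fun t => (\row_i g i t) 0 i) = g i by apply/funext => t; rewrite mxE.
split; last first.
  move=> i; apply: (weak_derivative_energy_bound (Lx i) (velocityP wx i)).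
  by move=> phi tphi; exact: limit_energy_test.
split=> //.
- apply/rowP => i; have z01 : 0 <= (0 : R) <= 1 by rewrite lexx ler01.
  apply/esym/(cvg_unique _ _ (@hx 0 i z01)) => //.
  have -> : (fun j => y j 0 0 i) = (fun=> xm 0 i) by apply/funext => j; have [_ -> _] := yW j.
  exact: cvg_cst.
- apply/rowP => i; have z01 : 0 <= (1 : R) <= 1 by rewrite lexx ler01.
  apply/esym/(cvg_unique _ _ (@hx 1 i z01)) => //.
  have -> : (fun j => y j 1 0 i) = (fun=> xp 0 i) by apply/funext => j; have [_ _ ->] := yW j.
  exact: cvg_cst.
Qed.

End limit.

End compactness.

(** * Existence of a minimizer *)

Lemma energy_ge0 (R : realType) (n : nat) (x : R -> 'rV[R]_n) : 0 <= energy x.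
Proof. by apply: sumr_ge0 => i _; exact: ip_ge0. Qed.

Lemma coord_energy_le (R : realType) (n : nat) (x : R -> 'rV[R]_n) i :
  coord_energy x i <= energy x.
Proof. by rewrite /energy (bigD1 i) //= lerDl sumr_ge0 // => j _; exact: ip_ge0. Qed.

Section minimizer.
Context (R : realType) (n : nat) (sigma k : R) (V : 'rV[R]_n -> R).
Local Notation mu := (@lebesgue_measure R).
Local Notation U := (effective_potential sigma V).
Local Notation action := (free_time_action (lagrangian sigma V) k).

Lemma potential_term_ge d (x : R -> 'rV[R]_n) : continuous U ->
  (forall z, d <= k - U z) -> W12 x ->
  d <= \int[mu]_(t in `]0, 1[) (k - U (x t)).
Proof.
move=> cU gap [cx _ _].
have <- : \int[mu]_(t in `]0, 1[) d = d.
  rewrite -[RHS]mulr1 -[RHS](ip_cst d 1) /ip.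
  by apply: eq_Rintegral => t _; rewrite mulr1.
apply: le_Rintegral => //; first exact: L2_integrable (L2_01_cst d).
apply: integrable_continuous_oo01.
apply: (@continuous_within_comp _ _ x (fun z => k - U z)) => // z.
exact: (cvgB (cvg_cst _) (cU z)).
Qed.

(** The direct method, for a potential [k - U] bounded below by [d > 0]. *)
Lemma exists_minimizer (xm xp : 'rV[R]_n) (d : R) : continuous U ->
  0 < d -> (forall z, d <= k - U z) -> xm <> xp ->
  exists (x : R -> 'rV[R]_n) (T : R), [/\ W12_between xm xp x, 0 < T &
    forall y S, W12_between xm xp y -> 0 < S -> action x T <= action y S].
Proof.
move=> cU d0 gap xmp.
pose P (x : R -> 'rV[R]_n) := \int[mu]_(t in `]0, 1[) (k - U (x t)).
have AE x T : W12_between xm xp x -> 0 < T ->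
    action x T = (2 * T)^-1 * energy x + T * P x.
  by move=> [wx _ _]; exact: free_time_actionE.
have Pd x : W12_between xm xp x -> d <= P x.
  by move=> [wx _ _]; exact: potential_term_ge.
pose A := [set a | exists x T, [/\ W12_between xm xp x, 0 < T & action x T = a]].
have A0 a : A a -> 0 <= a.
  move=> [x [T [wx T0 <-]]]; rewrite AE // addr_ge0 // mulr_ge0 ?energy_ge0 //.
  - by rewrite invr_ge0 mulr_ge0 // ltW.
  - exact: ltW.
  - exact: le_trans (ltW d0) (Pd x wx).
have infA : has_inf A.
  split; last by exists 0 => a /A0.
  have [x wx] := W12_between_neq0 xm xp.
  by exists (action x 1); exists x, 1.
pose m := inf A.
have m_le x T : W12_between xm xp x -> 0 < T -> m <= action x T.
  by move=> wx T0; apply: ge_inf; [case: infA|exists x, T].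
have m0 : 0 <= m by apply: lb_le_inf; [case: infA|move=> a /A0].
have /choice[p hp] (j : nat) : exists p : (R -> 'rV[R]_n) * R,
    [/\ W12_between xm xp p.1, 0 < p.2 & action p.1 p.2 <= m + harmonic j].
  have [_ [x [T [wx T0 <-]]] h] := inf_adherent (harmonic_gt0 (R := R) j) infA.
  by exists (x, T); split => //; exact: ltW.
pose y j := (p j).1; pose T_ j := (p j).2.
have yW j : W12_between xm xp (y j) by have [] := hp j.
have T_0 j : 0 < T_ j by have [] := hp j.
pose C := m + 1.
have C0 : 0 < C by rewrite /C ltr_wpDl.
have AC j : (2 * T_ j)^-1 * energy (y j) + T_ j * P (y j) <= C.
  rewrite -AE //; have [_ _ h] := hp j; apply: le_trans h _.
  by rewrite lerD2l invf_le1 // ler1n.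
(* The potential term alone is at least [d * T], which bounds [T] from above;
   then the kinetic term bounds the energy. *)
have TC j : T_ j <= C / d.
  rewrite ler_pdivlMr //; apply: le_trans (AC j).
  apply: (@le_trans _ _ (T_ j * P (y j))); first by rewrite ler_pM2l // Pd.
  by rewrite lerDr mulr_ge0 ?energy_ge0 // invr_ge0 mulr_ge0 // ltW.
have ET j : energy (y j) <= 2 * T_ j * C.
  rewrite -ler_pdivrMl ?mulr_gt0 //; apply: le_trans (AC j).
  by rewrite lerDl mulr_ge0 ?ltW // (lt_le_trans d0) // Pd.
pose M := 2 * (C / d) * C.
have EM j : energy (y j) <= M.
  apply: le_trans (ET j) _; rewrite /M ler_wpM2r ?(ltW C0) // ler_wpM2l //; exact: TC.
have yM j i : coord_energy (y j) i <= M := le_trans (coord_energy_le _ _) (EM j).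
(* A coordinate in which the endpoints differ forces a definite energy, hence a
   lower bound on [T]. *)
have [i hi] : exists i, xm 0 i != xp 0 i.
  apply/not_existsP => h; apply: xmp; apply/rowP => i.
  by have /negP := h i; rewrite negbK => /eqP.
pose w := (xp 0 i - xm 0 i) ^+ 2.
have w0 : 0 < w by rewrite /w exprn_even_gt0 //= subr_eq0 eq_sym.
have Tw j : w / (2 * C) <= T_ j.
  rewrite ler_pdivrMr ?mulr_gt0 //.
  have [wy y0 y1] := yW j.
  have := coord_holder (s := 0) (t := 1) i wy; rewrite y0 y1 subr0 normr1 mulr1 !lexx ler01.
  move=> /(_ isT isT) /le_trans; apply.
  apply: le_trans (coord_energy_le _ _) _.
  by apply: le_trans (ET j) _; rewrite -mulrA mulrCA.
have [G [GU subG]] := ultraFilterLemma (@eventually_filter).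
have [T /andP[wT _] cT] := ultra_bounded_cvg GU (fun j => introT andP (conj (Tw j) (TC j))).
have T0 : 0 < T by apply: lt_le_trans wT; rewrite divr_gt0 // mulr_gt0.
have exc l : exists b : R, coord_energy (y j) l @[j --> G] --> b.
  have [|b _ hb] := @ultra_bounded_cvg R G (fun j => coord_energy (y j) l) 0 M GU.
    by move=> j; rewrite yM andbT ip_ge0.
  by exists b.
have [c hc] := choice exc.
have [x hx] := pointwise_limit GU yW yM.
have [wx xc] := limit_W12 GU yW yM hx hc.
exists x, T; split; [exact: wx|exact: T0|move=> z S wz S0].
apply: le_trans (m_le z S wz S0).
have lim : (2 * T_ j)^-1 * (\sum_(l < n) coord_energy (y j) l) + T_ j * P (y j) @[j --> G]
    --> (2 * T)^-1 * (\sum_(l < n) c l) + T * P x.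
  apply: cvgD; apply: cvgM => //.
  - by apply: cvgV; [rewrite mulf_neq0 // gt_eqF|apply: cvgM => //; exact: cvg_cst].
  - by apply: cvg_big => [|l _]; [exact: add_continuous|exact: hc].
  - apply: (limit_integral GU yW yM hx (h := fun z => k - U z)) => v.
    exact: (cvgB (cvg_cst _) (cU v)).
have limH : m + harmonic j @[j --> G] --> m.
  rewrite -[X in _ --> X]addr0; apply: cvgD; first exact: cvg_cst.
  by apply: cvg_trans (@cvg_harmonic R); exact: cvg_app.
apply: (@le_trans _ _ ((2 * T)^-1 * (\sum_(l < n) c l) + T * P x)).
  rewrite AE // lerD2r ler_wpM2l ?invr_ge0 ?mulr_ge0 ?(ltW T0) //.
  by apply: ler_sum => l _; exact: xc.
apply: (ler_cvg_to lim limH); apply: nearW => j.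
by have [_ _ hj] := hp j; rewrite (AE _ _ (yW j) (T_0 j)) in hj; exact: hj.
Qed.

End minimizer.

Theorem theorem2p4 (R : realType) (n : nat) (sigma : R) (V : 'rV[R]_n -> R)
  (x0 x1 xm xp : 'rV[R]_n) (k : R)
  (sigma_gt0 : 0 < sigma)
  (V_C4 : class_C 4 V)
  (U_bounded_above : has_ubound (range (effective_potential sigma V)))
  (U_maximum_points : exists2 D : set 'rV[R]_n, bounded_domain D &
     maximum_points (effective_potential sigma V) `<=` D)
  (x0_neq_x1 : x0 <> x1)
  (x0_min : local_minimizer V x0) (x1_min : local_minimizer V x1)
  (grad_x0 : grad V x0 = 0) (grad_x1 : grad V x1 = 0)
  (laplacian_x0 : 0 < laplacian V x0) (laplacian_x1 : 0 < laplacian V x1)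
  (xm_neq_xp : xm <> xp)
  (k_gt : (mane_critical_value (lagrangian sigma V) < k%:E)%E) :
  exists (x : R -> 'rV[R]_n) (T : R),
    [/\ W12_between xm xp x, 0 < T &
        forall (y : R -> 'rV[R]_n) (S : R), W12_between xm xp y -> 0 < S ->
          free_time_action (lagrangian sigma V) k x T
          <= free_time_action (lagrangian sigma V) k y S].
Proof.
have [d d0 gap] := potential_gap k_gt.
exact: (exists_minimizer (continuous_effective_potential V_C4) d0 gap xm_neq_xp).
Qed.
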